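(* Let $\mathbb{K}$ be a field, $n\in\mathbb{N}$, $\mathbf{m}=(m_1,\dots,m_n)\in\mathbb{N}^n$, and let $R=\mathbb{K}[X_{ij} \mid 1\le i\le n,\ 1\le j\le m_i]$ be $\mathbb{Z}^n$-graded by $\deg X_{ij}=\mathbf{e}_i$. For a formal Laurent series $H\in\mathbb{Z}(\!(t_1,\dots,t_n)\!)$ the following statements are equivalent: (1) There exists a finitely generated $\mathbb{Z}^n$-graded $R$-module $M$ whose Hilbert series equals $H$. (2) $H$ satisfies the following two conditions: (a) $H\cdot\prod_{i=1}^n(1-t_i)^{m_i}$ is a Laurent polynomial; and (b) for every $\mathbf{u}\in\mathbb{Z}^n$ and every $I\subseteq[n]$, the Hilbert polynomial $\mathcal{P}(H|_{I,\mathbf{u}})$ of the restriction $H|_{I,\mathbf{u}}$ has positive extremal coefficients.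
   Context: $\mathbb{N}$ contains $0$; $[n]=\{1,\dots,n\}$; $\mathbf{e}_i$ is the $i$-th unit vector of $\mathbb{Z}^n$; $\mathbf{t}^{\mathbf{a}}=t_1^{a_1}\cdots t_n^{a_n}$; $\mathbb{Z}^n$ is partially ordered componentwise. $\mathbb{Z}(\!(t_1,\dots,t_n)\!)$ is the ring of formal series $\sum_{\mathbf{a}\in\mathbb{Z}^n}c_{\mathbf{a}}\mathbf{t}^{\mathbf{a}}$ with integer coefficients for which there is $\mathbf{b}\in\mathbb{Z}^n$ with $c_{\mathbf{a}}=0$ unless $\mathbf{a}\ge\mathbf{b}$. The Hilbert series of a finitely generated graded module $M=\bigoplus_{\mathbf{a}\in\mathbb{Z}^n}M_{\mathbf{a}}$ is $H_M=\sum_{\mathbf{a}}(\dim_{\mathbb{K}}M_{\mathbf{a}})\mathbf{t}^{\mathbf{a}}$. Restriction: for $H=\sum_{\mathbf{a}}h_{\mathbf{a}}\mathbf{t}^{\mathbf{a}}$, $I\subseteq[n]$, $\mathbf{u}\in\mathbb{Z}^n$, put $\mathbb{N}^I=\{\sum_{i\in I}c_i\mathbf{e}_i\mid c_i\in\mathbb{N}\}$ and $H|_{I,\mathbf{u}}=\sum_{\mathbf{a}\in\mathbb{N}^I}h_{\mathbf{u}+\mathbf{a}}\mathbf{t}^{\mathbf{a}}\in\mathbb{Z}(\!(t_i\mid i\in I)\!)$. Hilbert polynomial: if a formal Laurent series $G$ in variables $t_i$ ($i\in I$) becomes a Laurent polynomial after multiplication by some product $\prod_{i\in I}(1-t_i)^{d_i}$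 with $d_i\in\mathbb{N}$, then $\mathcal{P}(G)\in\mathbb{Q}[Z_i\mid i\in I]$ is the unique polynomial such that, for some $\mathbf{v}\in\mathbb{Z}^I$, the coefficient of $\mathbf{t}^{\mathbf{a}}$ in $G$ equals $\mathcal{P}(G)(\mathbf{a})$ for all $\mathbf{a}\ge\mathbf{v}$. If $I=\emptyset$, $G$ is an integer and $\mathcal{P}(G)=G$ (so $\mathcal{P}(H|_{\emptyset,\mathbf{u}})=h_{\mathbf{u}}$). If $H\cdot\prod_i(1-t_i)^{m_i}$ is a Laurent polynomial, every $H|_{I,\mathbf{u}}$ has such a Hilbert polynomial. Extremal coefficients: a monomial appearing (with nonzero coefficient) in a polynomial $p$ is extremal if it does not divide any other monomial appearing in $p$. The polynomial $p$ has positive extremal coefficients if the coefficient of every extremal monomial of $p$ is positive (vacuously true for $p=0$). *)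

(* Defs.v *)
From mathcomp Require Import all_boot all_order all_algebra.
From mathcomp Require Import mpoly.

Set Implicit Arguments.
Unset Strict Implicit.
Unset Printing Implicit Defensive.

Import Order.TTheory GRing.Theory Num.Theory.
Local Open Scope ring_scope.

Notation zvec n := 'rV[int]_n.

Definition zvec_of_mnm (n : nat) (k : 'X_{1..n}) : zvec n :=
  \row_i (k i)%:Z.

(* Formal series in t_1, ..., t_n are represented by their coefficient
   functions [zvec n -> int]. *)
Notation zseries n := (zvec n -> int).

Definition is_laurent_series (n : nat) (H : zseries n) : Prop :=
  exists b : zvec n, forall a : zvec n,
    H a != 0 -> forall i : 'I_n, b 0 i <= a 0 i.

Definition is_laurent_polynomial (n : nat) (H : zseries n) : Prop :=
  exists s : seq (zvec n), forall a : zvec n, H a != 0 -> a \in s.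

(* The Cauchy product of a polynomial in t_1, ..., t_n with a series. *)
Definition mul_series (n : nat) (p : {mpoly int[n]}) (H : zseries n) :
    zseries n :=
  fun a => \sum_(k <- msupp p) p@_k * H (a - zvec_of_mnm k).

Definition in_NI (n : nat) (I : {set 'I_n}) (a : zvec n) : bool :=
  [forall i, if i \in I then 0 <= a 0 i else a 0 i == 0].

(* The ring Z((t_i | i in I)) is viewed inside Z((t_1, ..., t_n)): its elements
   are the series supported on Z^I, the set of vectors that vanish outside I. *)
Definition restriction (n : nat) (H : zseries n) (I : {set 'I_n})
    (u : zvec n) : zseries n :=
  fun a => if in_NI I a then H (u + a) else 0.

Definition in_ZI (n : nat) (I : {set 'I_n}) (a : zvec n) : bool :=
  [forall i, (i \notin I) ==> (a 0 i == 0)].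

(* Q[Z_i | i in I] is viewed inside Q[Z_1, ..., Z_n]. *)
Definition mpoly_in (n : nat) (I : {set 'I_n}) (p : {mpoly rat[n]}) : Prop :=
  forall k : 'X_{1..n}, k \in msupp p -> forall i, i \notin I -> k i = 0%N.

(* P(G) = p, as a relation; it is functional by [hilbert_polynomial_unique]. *)
Definition is_hilbert_polynomial (n : nat) (I : {set 'I_n}) (G : zseries n)
    (p : {mpoly rat[n]}) : Prop :=
  mpoly_in I p /\
  exists2 v : zvec n, in_ZI I v &
    forall a : zvec n, in_ZI I a -> (forall i, v 0 i <= a 0 i) ->
      (G a)%:~R = p.@[fun i => (a 0 i)%:~R].

(* [(k <= l)%MM] is divisibility of monomials. *)
Definition extremal (n : nat) (p : {mpoly rat[n]}) (k : 'X_{1..n}) : Prop :=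
  k \in msupp p /\
  forall l : 'X_{1..n}, l \in msupp p -> (k <= l)%MM -> l = k.

Definition has_positive_extremal_coefficients (n : nat)
    (p : {mpoly rat[n]}) : Prop :=
  forall k : 'X_{1..n}, extremal p k -> 0 < p@_k.

Section GradedModules.
Variables (K : fieldType) (n : nat) (m : 'I_n -> nat).

(* The variables X_ij with i < n and j < m i are numbered by
   [tagnat.Rank : forall i, 'I_(m i) -> 'I_(\sum_i m i)]. *)
Definition Xring := {mpoly K[(\sum_(i < n) m i)%N]}.

Definition Xdeg (k : 'X_{1..(\sum_(i < n) m i)%N}) : zvec n :=
  \row_i (\sum_(j < m i) k (tagnat.Rank i j))%N%:Z.

Definition homogeneous (b : zvec n) (p : Xring) : Prop :=
  forall k, k \in msupp p -> Xdeg k = b.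

Record gradedModule := GradedModule {
  gcarrier :> lmodType {mpoly K[(\sum_(i < n) m i)%N]};
  gpiece : zvec n -> gcarrier -> Prop;
  gpiece0 : forall a, gpiece a 0;
  gpieceB : forall a x y, gpiece a x -> gpiece a y -> gpiece a (x - y);
  gpieceZ : forall a b (p : Xring) x,
    homogeneous b p -> gpiece a x -> gpiece (b + a) (p *: x);
  gpiece_sum : forall x : gcarrier,
    exists (s : seq (zvec n)) (f : zvec n -> gcarrier),
      (forall a, gpiece a (f a)) /\ x = \sum_(a <- s) f a;
  gpiece_direct : forall (s : seq (zvec n)) (f : zvec n -> gcarrier),
    uniq s -> (forall a, gpiece a (f a)) ->
    \sum_(a <- s) f a = 0 -> forall a, a \in s -> f a = 0
}.

Definition finitely_generated (M : gradedModule) : Prop :=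
  exists (r : nat) (g : 'I_r -> M), forall x : M,
    exists c : 'I_r -> Xring, x = \sum_(i < r) c i *: g i.

(* dim_K M_a = d; K acts on M through the constant polynomials. *)
Definition gpiece_dim (M : gradedModule) (a : zvec n) (d : nat) : Prop :=
  exists e : 'I_d -> M,
    [/\ forall i, gpiece a (e i),
        forall x : M, gpiece a x ->
          exists c : 'I_d -> K, x = \sum_(i < d) (c i)%:MP *: e i
      & forall c : 'I_d -> K,
          \sum_(i < d) (c i)%:MP *: e i = 0 -> forall i, c i = 0].

Definition is_hilbert_series (M : gradedModule) (H : zseries n) : Prop :=
  forall a : zvec n, exists2 d : nat, gpiece_dim M a d & H a = d%:Z.

End GradedModules.

Lemma kronecker_inj (B n : nat) (f g : nat -> nat) :
  (forall i, i < n -> f i < B)%N -> (forall i, i < n -> g i < B)%N ->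
  (\sum_(i < n) f i * B ^ i = \sum_(i < n) g i * B ^ i)%N ->
  forall i, (i < n)%N -> f i = g i.
Proof.
elim: n f g => [//|n IHn] f g fB gB.
have split (h : nat -> nat) : (\sum_(i < n.+1) h i * B ^ i =
    (\sum_(i < n) h i.+1 * B ^ i) * B + h 0)%N.
  rewrite big_ord_recl expn0 muln1 addnC big_distrl /=; congr (_ + _)%N.
  by apply: eq_bigr => i _; rewrite /bump /= add1n expnSr mulnA.
rewrite !split => E.
have B0 : (0 < B)%N by apply: leq_ltn_trans (fB 0%N isT).
have E0 : f 0%N = g 0%N.
  have := congr1 (modn^~ B) E.
  by rewrite /= !modnMDl !modn_small ?fB ?gB.
move: E; rewrite E0 => /addIn /eqP; rewrite eqn_pmul2r // => /eqP {}E [//|i] lt_i.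
by apply: (IHn (fun i => f i.+1) (fun i => g i.+1)) => // j lt_j;
  [apply: fB | apply: gB].
Qed.

Lemma mpoly_eq0_of_large (n : nat) (p : {mpoly rat[n]}) (v : nat) :
  (forall x : 'I_n -> nat, (forall i, v <= x i)%N ->
     p.@[fun i => (x i)%:R] = 0) -> p = 0.
Proof.
move=> p0; pose B := (msize p).+1.
pose code (k : 'X_{1..n}) := (\sum_(i < n) k i * B ^ i)%N.
have code_inj : {in msupp p &, injective code}.
  move=> k l kp lp E; apply/mnmP => i.
  pose ext (k : 'X_{1..n}) j := oapp (fun i : 'I_n => k i) 0%N (insub j).
  have extE (h : 'X_{1..n}) (j : 'I_n) : ext h j = h j.
    by rewrite /ext valK.
  have extB (h : 'X_{1..n}) : h \in msupp p ->
      forall j, (j < n)%N -> (ext h j < B)%N.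
    move=> hp j lt_j; rewrite -[j]/(val (Ordinal lt_j)) extE ltnS.
    apply: leq_trans (ltnW (msize_mdeg_lt hp)).
    by rewrite mdegE (bigD1 (Ordinal lt_j)) //= leq_addr.
  rewrite -!extE; apply: (@kronecker_inj B n) => //; try exact: extB.
  have cE (h : 'X_{1..n}) : (\sum_(j < n) ext h j * B ^ j)%N = code h.
    by apply: eq_bigr => j _; rewrite extE.
  by rewrite !cE.
pose q : {poly rat} := \sum_(k <- msupp p) p@_k *: 'X^(code k).
have q_large t : (v < t)%N -> q.[t%:R] = 0.
  move=> vt; have := p0 (fun i => t ^ (B ^ i))%N _; rewrite mevalE => <-.
    rewrite horner_sum; apply: eq_bigr => k _.
    rewrite hornerZ hornerXn; congr (_ * _).
    rewrite /code expr_sum; apply: eq_bigr => i _.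
    by rewrite natrX -exprM mulnC.
  move=> i; apply: leq_trans (ltnW vt) _.
  rewrite -[leqLHS]expn1 leq_pexp2l ?(leq_ltn_trans _ vt) //.
  by rewrite expn_gt0.
have q0 : q = 0.
  apply/eqP; apply: contraT => qn0.
  pose rs := [seq t%:R : rat | t <- iota v.+1 (size q)].
  have := @max_poly_roots _ q rs qn0.
  rewrite size_map size_iota ltnn; apply.
    apply/allP => x /mapP [t]; rewrite mem_iota => /andP [vt _] ->.
    by rewrite rootE q_large.
  rewrite map_inj_uniq ?iota_uniq // => s t /eqP.
  by rewrite eqr_nat => /eqP.
apply/mpolyP => k; rewrite mcoeff0.
have [kp|/memN_msupp_eq0 //] := boolP (k \in msupp p).
have : q`_(code k) = 0 by rewrite q0 coef0.
rewrite coef_sum (bigD1_seq k) ?msupp_uniq //= coefZ coefXn eqxx mulr1.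
rewrite big_seq_cond big1 ?addr0 // => l /andP [lp l_k].
rewrite coefZ coefXn; case: eqP => [E|_]; last by rewrite mulr0.
by rewrite (code_inj _ _ kp lp E) eqxx in l_k.
Qed.

Lemma hilbert_polynomial_unique (n : nat) (I : {set 'I_n}) (G : zseries n)
    (p q : {mpoly rat[n]}) :
  is_hilbert_polynomial I G p -> is_hilbert_polynomial I G q -> p = q.
Proof.
move=> [pI [v vI pG]] [qI [w wI qG]]; apply: subr0_eq.
pose V := (\sum_(i < n) (`|(v 0%R i : int)|%N + `|(w 0%R i : int)|%N))%N.
apply: (@mpoly_eq0_of_large n (p - q) V) => x.
have V_le i : (`|(v 0%R i : int)| + `|(w 0%R i : int)| <= V)%N.
  by rewrite /V (bigD1 i) //= leq_addr.
move=> le_x.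
pose a : zvec n := \row_i (if i \in I then (x i)%:Z else 0).
have evalI (r : {mpoly rat[n]}) : mpoly_in I r ->
    r.@[fun i => (x i)%:R] = r.@[fun i => (a 0 i)%:~R].
  move=> rI; rewrite !mevalE; apply: eq_big_seq => k kr; congr (_ * _).
  apply: eq_bigr => i _; rewrite mxE; case: ifP => // /negbT iI.
  by rewrite (rI k kr i iI) !expr0.
have aI : in_ZI I a.
  by apply/forallP => i; apply/implyP => /negbTE iI; rewrite mxE iI.
have large (z : zvec n) : (forall i, `|(z 0%R i : int)| <= x i)%N -> in_ZI I z ->
    forall i, z 0 i <= a 0 i.
  move=> zx /forallP zI i; rewrite mxE; case: ifP => [_|/negbT iI].
    by apply: le_trans (ler_norm _) _; rewrite -abszE lez_nat zx.
  by have /implyP /(_ iI) /eqP -> := zI i.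
have le_vx i : (`|(v 0%R i : int)| <= x i)%N.
  exact: leq_trans (leq_trans (leq_addr _ _) (V_le i)) (le_x i).
have le_wx i : (`|(w 0%R i : int)| <= x i)%N.
  exact: leq_trans (leq_trans (leq_addl _ _) (V_le i)) (le_x i).
rewrite mevalB !evalI // -pG ?subrr; [rewrite -qG ?subrr //; exact: large | by [] | exact: large].
Qed.

(* Main.v *)
From HB Require Import structures.
Require Import Defs.
From mathcomp Require Import all_boot all_order all_algebra.
From mathcomp Require Import mpoly.
From mathcomp Require Import boolp.
From mathcomp Require Import zify ring lra.

(** The theorem is proved through a third condition. Call a series [decomposable]
if it is a finite sum of series t^q / prod_i (1 - t_i)^(z_i) with
0 <= z_i <= m_i, repetitions allowed; both sides of the equivalence are
equivalent to being decomposable.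

From a module to a decomposition ([hilbert_series_decomposable]). Choose
homogeneous generators g and a monomial order. Call a multiple X^k g standard if
it is not a K-linear combination of multiples of the same degree that come
later, namely the X^l g with l < k and the multiples of the generators listed
after g. In each degree the standard multiples form a basis of the graded piece;
this is Gaussian elimination applied to all multiples of that degree. Since
multiplication by a monomial preserves the order, the exponents k for which
X^k g is standard are closed under taking divisors. By Dickson's lemma a set of
exponents closed under divisors is a finite disjoint union of translated
coordinate orthants ([decomposable_down_closed]), and a translated orthant
contributes one summand t^q / prod_i (1 - t_i)^(z_i).

From a decomposition to a module ([decomposable_module]). The summand
t^q / prod_i (1 - t_i)^(z_i) is the Hilbert series of the quotient of R by the
variables X_ij with j > z_i, shifted by q; direct sums add Hilbert series.

From a decomposition to the two conditions. The first is clear after m_i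
differences in each direction. For the second, the restriction of a summand has
as Hilbert polynomial either 0 or a product of univariate polynomials with
positive leading coefficients, hence a polynomial with a single maximal monomial,
whose coefficient is positive. In a sum of such polynomials
nothing can cancel at a maximal monomial ([sum_positive_top]).

From the two conditions to a decomposition ([hilbert_decomposable]). Write D_i for
the forward difference in direction i. The first condition says that
D_i^(m_i) H (x) vanishes once x_i is large, whatever the other
coordinates ([laurent_fdiff0]). The second gives, for given u and I, a polynomial
agreeing with H far out in u + N^I; as its extremal coefficients are positive, all
its iterated differences are nonnegative far out
([positive_extremal_abs_monotone]). Now expand H by Newton's formula at a far
point s of u + N^I: on s + N^I, H is the sum over k with k_i < m_i of
D^k H (s) times the product over i in I of binomial(x_i - s_i, k_i), and
binomial(x_i - s_i, k_i) is the coefficient of t_i^(x_i) in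
t_i^(s_i + k_i) / (1 - t_i)^(k_i + 1). So the part of H on s + N^I is
decomposable ([newton_decomposable]). What is left of u + N^I is
covered by finitely many translates of orthants of smaller dimension, which are
handled by induction on the cardinality of I ([orthant_part_decomposable]). *)

Set Implicit Arguments.
Unset Strict Implicit.
Unset Printing Implicit Defensive.

Import Order.TTheory GRing.Theory Num.Theory.
Local Open Scope ring_scope.

(** * Decomposable series *)

Definition evec (n : nat) (i : 'I_n) : zvec n := delta_mx 0 i.

Lemma evecE n (i j : 'I_n) : evec i 0 j = (j == i)%:Z.
Proof. by rewrite mxE eqxx natz. Qed.

Lemma add_scale_evecE n (a : zvec n) x (c i : 'I_n) :
  (a + x *: evec c) 0 i = a 0 i + (if i == c then x else 0).
Proof. by rewrite 2!mxE evecE; case: eqP => _; rewrite ?mulr1 ?mulr0. Qed.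

Lemma sub_scale_evecE n (a : zvec n) x (c i : 'I_n) :
  (a - x *: evec c) 0 i = a 0 i - (if i == c then x else 0).
Proof. by rewrite 3!mxE evecE; case: eqP => _; rewrite ?mulr1 ?mulr0. Qed.

Lemma add_evecE n (a : zvec n) (c i : 'I_n) : (a + evec c) 0 i = a 0 i + (i == c)%:Z.
Proof. by rewrite mxE evecE. Qed.

Lemma sub_evecE n (a : zvec n) (c i : 'I_n) : (a - evec c) 0 i = a 0 i - (i == c)%:Z.
Proof. by rewrite 2!mxE evecE. Qed.

(** The coefficient of t^y in (1 - t)^(-z). *)
Definition invpow_coef (z : nat) (y : int) : int :=
  match z, y with
  | 0%N, _ => (y == 0)%:Z
  | k.+1, Posz t => 'C(t + k, k)%:Z
  | _, Negz _ => 0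
  end.

Lemma invpow_coef_neg z y : y < 0 -> invpow_coef z y = 0.
Proof. by case: y z => // t [|z]. Qed.

Lemma invpow_coef_ge0 z y : 0 <= invpow_coef z y.
Proof. by case: z y => [|z] [] t. Qed.

Lemma invpow_coef00 z : invpow_coef z 0 = 1.
Proof. by case: z => //= z; rewrite add0n binn. Qed.

Lemma invpow_coef_pascal z y :
  invpow_coef z.+1 y - invpow_coef z.+1 (y - 1) = invpow_coef z y.
Proof.
case: y => [[|t]|t].
- by rewrite !invpow_coef00 invpow_coef_neg // subr0.
- have -> : (t.+1 : int) - 1 = t by lia.
  case: z => [|z] /=; first by rewrite !bin0 subrr.
  by rewrite addSn binS -addSnnS PoszD addrAC subrr add0r.
- have lt0 : Negz t - 1 < 0 by rewrite NegzE; lia.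
  by rewrite !invpow_coef_neg.
Qed.

(** The difference given by Pascal's rule telescopes, and the last term has a negative
argument. On generating series this is multiplication by 1 / (1 - t). *)
Lemma invpow_coef_sum z y (X : nat) : y < X%:Z ->
  \sum_(x < X) invpow_coef z (y - x%:Z) = invpow_coef z.+1 y.
Proof.
move=> yX.
have -> : invpow_coef z.+1 y =
    invpow_coef z.+1 (y - 0%N%:Z) - invpow_coef z.+1 (y - X%:Z).
  by rewrite subr0 [X in _ - X]invpow_coef_neg ?subr0 // subr_lt0.
elim: {yX} X => [|X IH]; first by rewrite big_ord0 subrr.
rewrite big_ord_recr /= IH -[invpow_coef z _]invpow_coef_pascal.
have -> : y - X.+1%:Z = y - X%:Z - 1 by lia.
by rewrite addrA subrK.
Qed.

(** This is what turns a term of a Newton expansion into a shifted power of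
1 / (1 - t). *)
Lemma invpow_coef_bin (t k : nat) : invpow_coef k.+1 (t%:Z - k%:Z) = 'C(t, k)%:Z.
Proof.
case: (leqP k t) => kt; first by rewrite subzn //= subnK.
rewrite bin_small // invpow_coef_neg //; lia.
Qed.

(** The coefficients of t^q / prod_i (1 - t_i)^(z_i). *)
Definition basic_series n (q : zvec n) (z : 'X_{1..n}) : zseries n :=
  fun a => \prod_i invpow_coef (z i) (a 0 i - q 0 i).

Lemma basic_series_self n (q : zvec n) z : basic_series q z q = 1.
Proof. by apply: big1 => i _; rewrite subrr invpow_coef00. Qed.

Lemma basic_series_exp0 n (a : zvec n) : basic_series 0 0%MM a = (a == 0)%:Z.
Proof.
rewrite /basic_series; case: eqP => [->|ne].
  by rewrite big1 // => i _; rewrite mnm0E mxE subrr.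
have [i ai] : exists i, a 0 i != 0.
  apply/existsP; apply: contra_notT ne => /existsPn a0.
  by apply/rowP => i; have := a0 i; rewrite negbK mxE => /eqP.
by rewrite (bigD1 i) //= mnm0E /= mxE subr0 (negbTE ai) mul0r.
Qed.

Lemma basic_series_ge0 n (q : zvec n) z a : 0 <= basic_series q z a.
Proof. by apply: prodr_ge0 => i _; apply: invpow_coef_ge0. Qed.

Definition decomposition n (s : seq (zvec n * 'X_{1..n})) : zseries n :=
  fun a => \sum_(qz <- s) basic_series qz.1 qz.2 a.

Definition decomposable n (m : 'I_n -> nat) (H : zseries n) : Prop :=
  exists2 s : seq (zvec n * 'X_{1..n}),
    forall qz, qz \in s -> forall i, (qz.2 i <= m i)%N &
    H =1 decomposition s.

Section Decomposable.
Variables (n : nat) (m : 'I_n -> nat).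
Implicit Types H : zseries n.

Lemma decomposable_ext H H' : H =1 H' -> decomposable m H -> decomposable m H'.
Proof. by move=> e [s sm sE]; exists s => // a; rewrite -e. Qed.

Lemma decomposable0 : decomposable m (fun=> 0).
Proof. by exists [::] => // a; rewrite /decomposition big_nil. Qed.

Lemma decomposableD H H' : decomposable m H -> decomposable m H' ->
  decomposable m (fun a => H a + H' a).
Proof.
move=> [s sm sE] [s' sm' sE']; exists (s ++ s').
  by move=> qz; rewrite mem_cat => /orP [/sm|/sm'].
by move=> a; rewrite sE sE' /decomposition big_cat.
Qed.

Lemma decomposable_sum (J : Type) (r : seq J) (F : J -> zseries n) :
  (forall j, decomposable m (F j)) ->
  decomposable m (fun a => \sum_(j <- r) F j a).
Proof.
move=> dF; elim: r => [|j r IH].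
  by apply: decomposable_ext decomposable0 => a; rewrite big_nil.
by apply: decomposable_ext (decomposableD (dF j) IH) => a; rewrite big_cons.
Qed.

Lemma decomposable_basic q (z : 'X_{1..n}) : (forall i, z i <= m i)%N ->
  decomposable m (basic_series q z).
Proof.
move=> zm; exists [:: (q, z)] => [qz|a]; first by rewrite inE => /eqP ->.
by rewrite /decomposition big_seq1.
Qed.

Lemma decomposable_muln c H : 0 <= c -> decomposable m H -> decomposable m (fun a => c * H a).
Proof.
case: c => // c _ dH; apply: decomposable_ext (decomposable_sum (iota 0 c) (fun=> dH)) => a.
by rewrite big_const_seq count_predT size_iota iter_addr addr0 -mulr_natl natz.
Qed.

Lemma decomposable_shift (d : zvec n) H : decomposable m H ->
  decomposable m (fun a => H (a - d)).
Proof.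
move=> [s sm sE]; exists [seq (qz.1 + d, qz.2) | qz <- s].
  by move=> _ /mapP [qz /sm qzm ->].
move=> a; rewrite sE /decomposition big_map; apply: eq_bigr => qz _.
by apply: eq_bigr => i _; rewrite !mxE /=; congr invpow_coef; lia.
Qed.

(** All summands have nonnegative coefficients, so the leading term t^q of a summand
survives in the sum. This bounds the shifts q by the support of the series. *)
Lemma decomposition_neq0 s (qz : zvec n * 'X_{1..n}) : qz \in s ->
  decomposition s qz.1 != 0.
Proof.
move=> qs; apply: lt0r_neq0; rewrite /decomposition (big_rem _ qs) /=.
rewrite basic_series_self ltr_wpDr //.
by apply: sumr_ge0 => x _; apply: basic_series_ge0.
Qed.

End Decomposable.

Lemma basic_series_sum n (q a : zvec n) z c (X : nat) : a 0 c - q 0 c < X%:Z ->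
  \sum_(x < X) basic_series q z (a - x%:Z *: evec c) = basic_series q (z + U_(c)) a.
Proof.
move=> aX; rewrite /basic_series [RHS](bigD1 c) //=.
rewrite mnmDE mnm1E eqxx addn1 -(invpow_coef_sum _ aX) big_distrl /=.
apply: eq_bigr => x _; rewrite (bigD1 c) //=; congr (_ * _).
  by rewrite sub_scale_evecE eqxx; congr invpow_coef; lia.
apply: eq_bigr => i ic; rewrite mnmDE mnm1E eq_sym (negbTE ic) addn0.
by rewrite sub_scale_evecE (negbTE ic) subr0.
Qed.

(** Cumulative summation in direction c multiplies a series by 1 / (1 - t_c). The
support condition makes the finite range of summation long enough: the shift q of
each summand then satisfies q_c >= 0 by [decomposition_neq0]. *)
Lemma decomposable_cumul n (m m' : 'I_n -> nat) (c : 'I_n) (H : zseries n) :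
  (forall i, m i + (i == c) <= m' i)%N ->
  (forall a : zvec n, H a != 0 -> 0 <= a 0 c) ->
  decomposable m H ->
  decomposable m' (fun a : zvec n => \sum_(x < `|a 0%R c|.+1) H (a - x%:Z *: evec c)).
Proof.
move=> mm' H0 [s sm sE]; exists [seq (qz.1, (qz.2 + U_(c))%MM) | qz <- s].
  move=> _ /mapP [qz /sm qzm ->] i /=; apply: leq_trans (mm' i).
  by rewrite mnmDE mnm1E (eq_sym c) leq_add2r.
move=> a; rewrite /decomposition big_map /=.
transitivity (\sum_(x < `|a 0%R c|.+1) decomposition s (a - x%:Z *: evec c)).
  by apply: eq_bigr => x _; rewrite sE.
rewrite /decomposition exchange_big /= !big_seq; apply: eq_bigr => qz qzs.
apply: basic_series_sum.
have := H0 qz.1; rewrite sE => /(_ (decomposition_neq0 qzs)).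
by move: (a 0 c) (qz.1 0 c) => x y; lia.
Qed.

(** * Finite differences and Laurent polynomials *)

Section Differences.
Variables (n : nat).
Implicit Types (F : zvec n -> int) (i j : 'I_n) (a b : zvec n).

Lemma mul_series_sub (p : {mpoly int[n]}) (s : seq 'X_{1..n}) (H : zseries n) a :
  uniq s -> {subset msupp p <= s} ->
  mul_series p H a = \sum_(k <- s) p@_k * H (a - zvec_of_mnm k).
Proof.
move=> us sub; rewrite /mul_series [RHS](bigID (mem (msupp p))) /=.
rewrite [X in _ + X]big1 ?addr0 => [|k /memN_msupp_eq0 ->]; last by rewrite mul0r.
rewrite -[RHS]big_filter; apply: perm_big; apply: uniq_perm; rewrite ?filter_uniq //.
by move=> k; rewrite mem_filter; case: (boolP (k \in msupp p)) => // /sub ->.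
Qed.

Lemma mul_seriesB (p q : {mpoly int[n]}) (H : zseries n) a :
  mul_series (p - q) H a = mul_series p H a - mul_series q H a.
Proof.
set s := undup (msupp p ++ msupp q).
have us : uniq s by apply: undup_uniq.
rewrite !(@mul_series_sub _ s) //.
- by rewrite -sumrB; apply: eq_bigr => k _; rewrite mcoeffB mulrBl.
- by move=> k kq; rewrite mem_undup mem_cat kq orbT.
- by move=> k kq; rewrite mem_undup mem_cat kq.
- by move=> k /msuppB_le; rewrite mem_undup.
Qed.

(** Together with [mul_seriesB], multiplication by 1 - t_i becomes a difference
operator. *)
Lemma mul_seriesXU (q : {mpoly int[n]}) i (H : zseries n) a :
  mul_series (q * 'X_i) H a = mul_series q H (a - evec i).
Proof.
rewrite /mul_series (perm_big _ (msuppMX q _)) big_map; apply: eq_bigr => k _.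
rewrite mcoeffMX; congr (_ * H _); apply/rowP => j.
by rewrite !mxE mnmDE mnm1E eqxx eq_sym /=; case: (j == i) => /=; lia.
Qed.

(** Forward differences keep a region of the form x >= v stable, so one threshold v
serves for all iterates; multiplication by 1 - t_i is the backward difference, a
shift of this one. *)
Definition fdiff (V : zmodType) i (F : zvec n -> V) : zvec n -> V :=
  fun a => F (a + evec i) - F a.

Definition fdiffs (m : 'I_n -> nat) (r : seq 'I_n) F : zvec n -> int :=
  foldr (fun i G => iter (m i) (fdiff i) G) F r.

Lemma iter_fdiff_shift k i F b :
  iter k (fdiff i) (fun a => F (a - b)) = (fun a => iter k (fdiff i) F (a - b)).
Proof.
elim: k => //= k ->; apply/funext => a; rewrite /fdiff.
by congr (iter k _ F _ - _); rewrite addrAC.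
Qed.

Lemma fdiffC i j F : fdiff i (fdiff j F) = fdiff j (fdiff i F).
Proof.
apply/funext => a; rewrite /fdiff (addrAC a (evec j)).
ring.
Qed.

Lemma iter_fdiffC k l i j F :
  iter k (fdiff i) (iter l (fdiff j) F) = iter l (fdiff j) (iter k (fdiff i) F).
Proof.
have C (G : zvec n -> int) l' :
    fdiff i (iter l' (fdiff j) G) = iter l' (fdiff j) (fdiff i G).
  by elim: l' => //= l' IH; rewrite fdiffC IH.
by elim: k => //= k ->; rewrite C.
Qed.

Lemma fdiffs_rem m i r F : i \in r ->
  fdiffs m r F = fdiffs m (rem i r) (iter (m i) (fdiff i) F).
Proof.
elim: r => //= j r IH; rewrite inE; case: eqVneq => [-> _|ne /= ir] /=.
  by elim: r {IH} => //= l r IH; rewrite iter_fdiffC IH.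
by rewrite -IH.
Qed.

Lemma mul_series_fdiff (q : {mpoly int[n]}) i k (H : zseries n) :
  mul_series ((1 - 'X_i) ^+ k * q) H =
  fun a => iter k (fdiff i) (mul_series q H) (a - k%:Z *: evec i).
Proof.
elim: k => [|k IH]; apply/funext => a; first by rewrite expr0 mul1r scale0r subr0.
rewrite exprS -mulrA mulrBl mul1r mul_seriesB [_ * (_ * q)]mulrC mul_seriesXU IH /=.
rewrite /fdiff; set G := iter k _ _; congr (G _ - G _).
  by apply/rowP => j; rewrite !mxE; lia.
by apply/rowP => j; rewrite !mxE; lia.
Qed.

Lemma mul_series_fdiffs (m : 'I_n -> nat) r (H : zseries n) :
  mul_series (\prod_(i <- r) (1 - 'X_i) ^+ m i) H =
  fun a => fdiffs m r H (a - \sum_(i <- r) (m i)%:Z *: evec i).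
Proof.
elim: r => [|i r IH].
  apply/funext => a; rewrite !big_nil /mul_series msupp1 big_seq1 mcoeff1 eqxx mul1r.
  by congr H; apply/rowP => j; rewrite !mxE mnm0E.
rewrite big_cons mul_series_fdiff IH iter_fdiff_shift; apply/funext => a.
by rewrite big_cons opprD addrA.
Qed.

Definition bounded_above i F := exists b : int, forall a, F a != 0 -> a 0 i <= b.

Lemma fdiff_neq0 i F a : fdiff i F a != 0 -> F (a + evec i) != 0 \/ F a != 0.
Proof.
rewrite /fdiff; have [->|] := eqVneq (F (a + evec i)) 0; last by left.
by rewrite sub0r oppr_eq0; right.
Qed.

Lemma laurent_series_fdiff j F : is_laurent_series F -> is_laurent_series (fdiff j F).
Proof.
move=> [b bF]; exists (b - evec j) => a /fdiff_neq0 [] /bF ba i; have := ba i.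
all: rewrite sub_evecE ?add_evecE; case: (_ == _) => /=; lia.
Qed.

Lemma bounded_above_fdiff i j F : bounded_above i F -> bounded_above i (fdiff j F).
Proof.
move=> [b bF]; exists b => a /fdiff_neq0 [] /bF //.
rewrite add_evecE; case: (_ == _) => /=; lia.
Qed.

Lemma iter_fdiff_ind (P : (zvec n -> int) -> Prop) i k F :
  (forall G, P G -> P (fdiff i G)) -> P F -> P (iter k (fdiff i) F).
Proof. by move=> Pd PF; elim: k => //= k; apply: Pd. Qed.

Lemma fdiffs_ind (P : (zvec n -> int) -> Prop) m r F :
  (forall i G, P G -> P (fdiff i G)) -> P F -> P (fdiffs m r F).
Proof. by move=> Pd PF; elim: r => //= i r IH; apply: (@iter_fdiff_ind P) => // G; apply: Pd. Qed.

(** A support bounded on both sides in every direction lies in a finite box. *)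
Lemma laurent_polynomial_bounded F :
  is_laurent_series F -> (forall i, bounded_above i F) -> is_laurent_polynomial F.
Proof.
move=> [b bF] /choice [c cF].
pose L := (\sum_(i < n) `|c i - b 0%R i|)%N.
exists [seq b + \row_i (f i)%:Z | f : {ffun 'I_n -> 'I_L.+1}] => a Fa.
have fL i : (`|a 0%R i - b 0%R i| < L.+1)%N.
  have := bF _ Fa i; have := cF i _ Fa; rewrite ltnS => le1 le2.
  apply: (@leq_trans `|c i - b 0%R i|); last by rewrite /L (bigD1 i) //= leq_addr.
  by move: (a 0 i) (b 0 i) (c i) le1 le2 => x y z; lia.
apply/imageP; exists [ffun i => Ordinal (fL i)] => //.
apply/rowP => i; rewrite !mxE ffunE /=.
by have := bF _ Fa i; move: (a 0 i) (b 0 i) => x y; lia.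
Qed.

Lemma laurent_polynomial_above F (s : zvec n) : is_laurent_polynomial F ->
  exists N : int, forall i a, N <= a 0 i -> F (a - s) = 0.
Proof.
move=> [l lF]; exists (\sum_(b <- l) \sum_i `|b 0 i + s 0 i| + 1) => i a.
apply: contraTeq => /lF al; rewrite -ltNge ltzD1.
rewrite (big_rem _ al) /= (bigD1 i) //= !mxE.
have : 0 <= \sum_(i0 < n | i0 != i) `|(a - s) 0 i0 + s 0 i0| + \sum_(y <- rem (a - s) l) \sum_(i0 < n) `|y 0 i0 + s 0 i0|.
  by rewrite addr_ge0 ?sumr_ge0 // => *; rewrite sumr_ge0.
rewrite -addrA; move: (_ + _) (a 0 i) (s 0 i) => x y z; lia.
Qed.

End Differences.

Section DecomposableLaurent.
Variables (n : nat) (m : 'I_n -> nat).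

Lemma fdiff_basic (q : zvec n) (z : 'X_{1..n}) i : (0 < z i)%N ->
  fdiff i (basic_series q z) = basic_series (q - evec i) (z - U_(i)).
Proof.
move=> zi; apply/funext => a; rewrite /fdiff /basic_series.
rewrite (bigD1 i) //= [X in _ - X](bigD1 i) //= [RHS](bigD1 i) //=.
rewrite [X in _ * X - _](eq_bigr (fun j => invpow_coef (z j) (a 0 j - q 0 j))).
  rewrite -mulrBl; congr (_ * _); last first.
    apply: eq_bigr => j ji; rewrite mnmBE mnm1E eq_sym (negbTE ji) subn0.
    by rewrite sub_evecE (negbTE ji) subr0.
  rewrite mnmBE mnm1E eqxx subn1 -[in RHS]invpow_coef_pascal prednK //.
  by rewrite sub_evecE add_evecE !eqxx /=; congr (invpow_coef _ _ - invpow_coef _ _); lia.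
by move=> j ji; rewrite add_evecE (negbTE ji) addr0.
Qed.

(** The first z_i differences reduce the exponent of 1 - t_i to 0, which leaves a
series supported on one hyperplane; further differences keep the bound. *)
Lemma bounded_above_basic (q : zvec n) (z : 'X_{1..n}) i k : (z i <= k)%N ->
  bounded_above i (iter k (fdiff i) (basic_series q z)).
Proof.
have b0 q' (z' : 'X_{1..n}) : z' i = 0%N -> bounded_above i (basic_series q' z').
  move=> z0; exists (q' 0 i) => a; apply: contraNT; rewrite -ltNge => qa.
  rewrite /basic_series (bigD1 i) //= z0 /=.
  by case: eqP; rewrite ?mul0r //; lia.
elim: k q z => [|k IH] q z; first by rewrite leqn0 => /eqP; apply: b0.
case: (posnP (z i)) => [z0 _|z0 zk].
  by apply: iter_fdiff_ind (b0 _ _ z0) => G; apply: bounded_above_fdiff.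
rewrite iterSr fdiff_basic //; apply: IH.
by rewrite mnmBE mnm1E eqxx; lia.
Qed.

Lemma bounded_above_decomposable (H : zseries n) i : decomposable m H ->
  bounded_above i (iter (m i) (fdiff i) H).
Proof.
move=> [s sm /funext ->]; elim: s sm => [|qz s IH] sm.
  exists 0 => a; rewrite (_ : decomposition [::] = fun=> 0); last first.
    by apply/funext => b; rewrite /decomposition big_nil.
  suff -> : iter (m i) (fdiff i) (fun=> 0) = (fun=> 0 : int) by rewrite eqxx.
  by elim: (m i) => //= k ->; apply/funext => b; rewrite /fdiff subrr.
have -> : decomposition (qz :: s) = fun a => basic_series qz.1 qz.2 a + decomposition s a.
  by apply/funext => a; rewrite /decomposition big_cons.
have add (F G : zvec n -> int) k : iter k (fdiff i) (fun a => F a + G a) =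
    fun a => iter k (fdiff i) F a + iter k (fdiff i) G a.
  by elim: k => //= k ->; apply/funext => a; rewrite /fdiff; lia.
rewrite add; have [|b bs] := IH; first by move=> x xs; apply: sm; rewrite inE xs orbT.
have [c cq] := bounded_above_basic qz.1 (sm qz (mem_head _ _) i).
exists (Num.max b c) => a.
have [->|/cq ca _] := eqVneq (iter (m i) (fdiff i) (basic_series qz.1 qz.2) a) 0.
  by rewrite add0r => /bs ab; rewrite le_max ab.
by rewrite le_max ca orbT.
Qed.

Lemma decomposable_laurent (H : zseries n) : is_laurent_series H -> decomposable m H ->
  is_laurent_polynomial (mul_series (\prod_(i < n) (1 - 'X_i) ^+ m i) H).
Proof.
move=> H0 dH; rewrite mul_series_fdiffs.
set d := \sum_(i < n) _.
suff [l lF] : is_laurent_polynomial (fdiffs m (index_enum 'I_n) H).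
  exists [seq b + d | b <- l] => a /lF al; rewrite -[a](subrK d).
  by apply: map_f.
apply: laurent_polynomial_bounded.
  by apply: fdiffs_ind => // i G; apply: laurent_series_fdiff.
move=> i; rewrite (fdiffs_rem _ _ (mem_index_enum i)).
apply: fdiffs_ind => [j G|]; first exact: bounded_above_fdiff.
exact: bounded_above_decomposable.
Qed.

(** If D_j G = 0 along a ray in direction -e_j, then G is constant on it, and hence 0
because the support of G is bounded below. *)
Lemma fdiff_vanish (P : pred (zvec n)) (F : zvec n -> int) j k : is_laurent_series F ->
  (forall a, P a -> P (a - evec j)) ->
  (forall a, P a -> iter k (fdiff j) F a = 0) -> forall a, P a -> F a = 0.
Proof.
move=> bF Pj; elim: k => [//|k IH] k0; apply: IH => a Pa.
set G := iter k (fdiff j) F in k0 *.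
have [b bG] : is_laurent_series G by apply: iter_fdiff_ind bF => G'; apply: laurent_series_fdiff.
have step t : P (a - t%:Z *: evec j) /\ G (a - t%:Z *: evec j) = G a.
  elim: t => [|t [Pt <-]]; first by rewrite scale0r subr0.
  have -> : a - t.+1%:Z *: evec j = a - t%:Z *: evec j - evec j.
    by apply/rowP => i; rewrite !mxE; lia.
  split; first exact: Pj.
  have := k0 _ (Pj _ Pt); rewrite /= /fdiff subrK => /eqP.
  by rewrite subr_eq0 => /eqP.
have [_ <-] := step `|a 0%R j - b 0%R j|.+1.
apply/eqP; apply: contraT => /bG /(_ j); rewrite sub_scale_evecE eqxx.
by move: (a 0 j) (b 0 j) => x y; lia.
Qed.

(** The iterated difference in all directions vanishes where x_i >= N. The operators in the
directions j other than i can then be removed one by one with [fdiff_vanish], as the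
region x_i >= N is stable under -e_j. *)
Lemma laurent_fdiff0 (H : zseries n) : is_laurent_series H ->
  is_laurent_polynomial (mul_series (\prod_(i < n) (1 - 'X_i) ^+ m i) H) ->
  exists N : int, forall i (a : zvec n), N <= a 0 i -> iter (m i) (fdiff i) H a = 0.
Proof.
move=> bH; rewrite mul_series_fdiffs.
set d := \sum_(i < n) _ => /(@laurent_polynomial_above _ _ (- d)) [N NF].
exists N => i.
have {NF} : forall a : zvec n, N <= a 0 i -> fdiffs m (index_enum 'I_n) H a = 0.
  by move=> a /NF; rewrite opprK addrK.
rewrite (fdiffs_rem _ _ (mem_index_enum i)).
have : i \notin rem i (index_enum 'I_n) by rewrite mem_rem_uniqF // index_enum_uniq.
have : is_laurent_series (iter (m i) (fdiff i) H).
  by apply: iter_fdiff_ind => // G; apply: laurent_series_fdiff.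
elim: (rem i _) => [|j r IH] bG; first by [].
rewrite inE negb_or => /andP [ij ir] F0; apply: IH => //.
apply: (@fdiff_vanish (fun a : zvec n => N <= a 0 i) _ j (m j)) F0.
  by apply: fdiffs_ind => // l G; apply: laurent_series_fdiff.
by move=> a; rewrite sub_evecE (negbTE ij) subr0.
Qed.

End DecomposableLaurent.

(** * Hilbert polynomials of decomposable series *)

(** The polynomials with exactly one extremal monomial, its coefficient being positive;
zero is included because a factor vanishes when z_i = 0. *)
Definition has_positive_top n (p : {mpoly rat[n]}) : Prop :=
  p = 0 \/ exists2 k, 0 < p@_k & forall l, l \in msupp p -> (l <= k)%MM.

Section PositiveTop.
Variable n : nat.
Implicit Types p q : {mpoly rat[n]}.

Lemma positive_topZ c p : 0 <= c -> has_positive_top p -> has_positive_top (c *: p).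
Proof.
rewrite le_eqVlt => /predU1P [<- _|c0]; first by left; rewrite scale0r.
case=> [->|[k k0 kp]]; first by left; rewrite scaler0.
by right; exists k; [rewrite mcoeffZ mulr_gt0 | move=> l /msuppZ_le /kp].
Qed.

Lemma positive_topM p q : has_positive_top p -> has_positive_top q -> has_positive_top (p * q).
Proof.
case=> [->|[k k0 kp]]; first by left; rewrite mul0r.
case=> [->|[l l0 lq]]; first by left; rewrite mulr0.
have lead (r : {mpoly rat[n]}) e : 0 < r@_e -> (forall f, f \in msupp r -> (f <= e)%MM) ->
    (mlead r <= e)%O.
  move=> e0 er; apply/lem_leo/er/mlead_supp.
  by apply: contraTneq e0 => ->; rewrite mcoeff0 ltxx.
right; exists (k + l)%MM; first by rewrite mleadcMW ?lead // mulr_gt0.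
move=> e /msuppM_le /allpairsP [[e1 e2] /= [/kp le1 /lq le2 ->]].
by apply/mnm_lepP => i; rewrite !mnmDE leq_add //; apply/mnm_lepP.
Qed.

Lemma positive_top1 : has_positive_top (1 : {mpoly rat[n]}).
Proof.
right; exists 0%MM; first by rewrite mcoeff1 eqxx.
by move=> l; rewrite msupp1 inE => /eqP ->; apply: lepm_refl.
Qed.

Lemma positive_top_prod (J : Type) (r : seq J) (P : pred J) (F : J -> {mpoly rat[n]}) :
  (forall j, has_positive_top (F j)) -> has_positive_top (\prod_(j <- r | P j) F j).
Proof. by move=> tF; apply: big_ind => // [|? ?]; [apply: positive_top1|apply: positive_topM]. Qed.

Lemma positive_top_lin i c : has_positive_top ('X_i + c%:MP : {mpoly rat[n]}).
Proof.
right; exists U_(i)%MM => [|l].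
  by rewrite mcoeffD mcoeffXU mcoeffC eqxx mnm1_eq0 mulr0 addr0.
move/msuppD_le; rewrite mem_cat msuppX inE => /orP [/eqP ->|].
  exact: lepm_refl.
rewrite msuppC; case: eqP => // _; rewrite inE => /eqP ->.
by apply/mnm_lepP => j; rewrite mnm0E.
Qed.

Lemma seq_argmax (T : eqType) (f : T -> nat) (s : seq T) x : x \in s ->
  exists2 y, y \in s & forall z, z \in s -> (f z <= f y)%N.
Proof.
move=> xs; have xi : (index x s < size s)%N by rewrite index_mem.
have [i _ imax] := @arg_maxnP _ (Ordinal xi) xpredT (fun i => f (nth x s i)) isT.
exists (nth x s i); first exact: mem_nth.
by move=> z zs; have := imax (Ordinal (etrans (index_mem z s) zs)) isT; rewrite /= nth_index.
Qed.

(** Let k be extremal in the sum and l a monomial of largest degree among those above k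
occurring in some summand. Any summand in which l occurs has l as its top, so the
coefficients at l add up to a positive number; then l occurs in the sum and k = l. *)
Lemma sum_positive_top (J : eqType) (r : seq J) (F : J -> {mpoly rat[n]}) :
  (forall j, j \in r -> has_positive_top (F j)) ->
  has_positive_extremal_coefficients (\sum_(j <- r) F j).
Proof.
move=> tF k [kp kmax].
pose s := [seq l <- flatten [seq (msupp (F j) : seq _) | j <- r] | (k <= l)%MM].
have sP l j : j \in r -> l \in msupp (F j) -> (k <= l)%MM -> l \in s.
  by move=> jr lj kl; rewrite mem_filter kl; apply/flatten_mapP; exists j.
have [j0 j0r kj0] : exists2 j, j \in r & k \in msupp (F j).
  apply/hasP; move: kp; apply: contraTT => /hasPn nk.
  rewrite mcoeff_msupp negbK raddf_sum /= big_seq big1 // => j /nk.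
  by move/memN_msupp_eq0.
have [l ls lmax] := seq_argmax mdeg (sP _ _ j0r kj0 (lepm_refl k)).
have /andP [kl /flatten_mapP [j jr lj]] : (k <= l)%MM && (l \in flatten [seq (msupp (F j) : seq _) | j <- r]).
  by move: ls; rewrite mem_filter.
have ge0 i : i \in r -> 0 <= (F i)@_l /\ (l \in msupp (F i) -> 0 < (F i)@_l).
  move=> ir; have [li|/memN_msupp_eq0 ->] := boolP (l \in msupp (F i)); last by [].
  suff l0 : 0 < (F i)@_l by rewrite ltW.
  case: (tF i ir) => [F0|[e e0 eF]]; first by move: li; rewrite F0 msupp0.
  suff -> : l = e by [].
  have le := eF _ li; have ei : e \in msupp (F i) by rewrite mcoeff_msupp gt_eqF.
  have := lmax _ (sP _ _ ir ei (lepm_trans kl le)).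
  rewrite -{1}(submK le) mdegD.
  rewrite -[X in (_ <= X)%N -> _]add0n leq_add2r leqn0.
  by rewrite mdeg_eq0 => /eqP d0; rewrite -(submK le) d0 add0m.
have p0 : 0 < (\sum_(j <- r) F j)@_l.
  rewrite raddf_sum /= (big_rem _ jr) /= ltr_pwDl ?(ge0 j jr).2 //.
  by rewrite big_seq; apply: sumr_ge0 => i /mem_rem /ge0 [].
by rewrite -(kmax l) // mcoeff_msupp gt_eqF.
Qed.
End PositiveTop.

Section HilbertPolynomials.
Variable n : nat.
Implicit Types (I : {set 'I_n}) (u v : zvec n).

Lemma hilbert_polynomial_sum I (J : Type) (r : seq J) (G : J -> zseries n) p :
  (forall j, is_hilbert_polynomial I (G j) (p j)) ->
  is_hilbert_polynomial I (fun a => \sum_(j <- r) G j a) (\sum_(j <- r) p j).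
Proof.
move=> Gp; elim: r => [|j r [pI [v vI IH]]].
  split; first by move=> k; rewrite big_nil msupp0.
  exists 0 => [|a _ _]; last by rewrite !big_nil meval0.
  by apply/forallP => i; rewrite mxE eqxx implybT.
have [qI [w wI qG]] := Gp j; split.
  by move=> k; rewrite big_cons => /msuppD_le; rewrite mem_cat => /orP [/qI|/pI].
exists (\row_i Num.max (v 0 i) (w 0 i)).
  apply/forallP => i; apply/implyP => iI; rewrite mxE.
  move: vI wI => /forallP /(_ i) /implyP /(_ iI) /eqP -> /forallP /(_ i) /implyP /(_ iI) /eqP ->.
  by rewrite maxxx.
move=> a aI va; rewrite !big_cons rmorphD /= mevalD qG ?IH // => i.
all: by have := va i; rewrite mxE ge_max => /andP [].
Qed.

(** The polynomial (Z_i + s + 1) ... (Z_i + s + k) / k! with k = z - 1, which gives the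
coefficients of t^(-s) / (1 - t)^z far out. *)
Definition invpow_poly (z : nat) (s : int) (i : 'I_n) : {mpoly rat[n]} :=
  if z is k.+1 then
    (k`!%:R)^-1 *: \prod_(j < k) ('X_i + (s + j.+1%:Z)%:~R%:MP)
  else 0.

Lemma invpow_polyE z (s : int) i (x : 'I_n -> rat) (y : int) :
  x i = y%:~R -> 0 < y + s -> (invpow_poly z s i).@[x] = (invpow_coef z (y + s))%:~R.
Proof.
move=> xi; case: z => [|k] /= ys; first by rewrite meval0 gt_eqF.
have [t ->] : exists t : nat, s = t%:Z - y by exists `|(y + s)%R|%N; lia.
rewrite mevalZ rmorph_prod /= (addrC y) subrK.
have -> : \prod_(j < k) ('X_i + (t%:Z - y + j.+1%:Z)%:~R%:MP).@[x] = ((t + k) ^_ k)%:R.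
  elim: k => [|k IH]; first by rewrite big_ord0.
  rewrite big_ord_recr /= IH addnS ffactSS mulnC natrM; congr (_ * _).
  rewrite mevalD mevalXU mevalC xi -rmorphD /= [RHS]pmulrn; congr (_%:~R); lia.
rewrite -bin_ffact natrM mulrC mulfK //.
by rewrite pnatr_eq0 -lt0n fact_gt0.
Qed.

Definition restricted_basic_poly I u (q : zvec n) (z : 'X_{1..n}) : {mpoly rat[n]} :=
  (\prod_(i | i \notin I) invpow_coef (z i) (u 0 i - q 0 i))%:~R *:
  \prod_(i in I) invpow_poly (z i) (u 0 i - q 0 i) i.

Lemma restricted_basic_poly_top I u q z : has_positive_top (restricted_basic_poly I u q z).
Proof.
apply: positive_topZ.
  by rewrite ler0z prodr_ge0 // => i _; apply: invpow_coef_ge0.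
apply: positive_top_prod => i; rewrite /invpow_poly; case: (z i) => [|k]; first by left.
apply: positive_topZ; first by rewrite invr_ge0.
by apply: positive_top_prod => j; apply: positive_top_lin.
Qed.

Lemma mpoly_inZ I c p : mpoly_in I p -> mpoly_in I (c *: p).
Proof. by move=> pI k /msuppZ_le; apply: pI. Qed.

Lemma mpoly_in_prod I (J : Type) (r : seq J) (P : pred J) (F : J -> {mpoly rat[n]}) :
  (forall j, P j -> mpoly_in I (F j)) -> mpoly_in I (\prod_(j <- r | P j) F j).
Proof.
move=> FI; apply: (big_ind (mpoly_in I)) => // [k|p q pI qI k].
  by rewrite msupp1 inE => /eqP -> i _; rewrite mnm0E.
move/msuppM_le => /allpairsP [[k1 k2] /= [/pI k1I /qI k2I ->]] i iI.
by rewrite mnmDE k1I ?k2I.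
Qed.

Lemma hilbert_polynomial_basic I u q z :
  is_hilbert_polynomial I (restriction (basic_series q z) I u) (restricted_basic_poly I u q z).
Proof.
split.
  apply/mpoly_inZ/mpoly_in_prod => i iI; rewrite /invpow_poly; case: (z i) => [|k].
    by move=> k; rewrite msupp0.
  apply/mpoly_inZ/mpoly_in_prod => j _ l /msuppD_le; rewrite mem_cat msuppX inE.
  case/orP => [/eqP -> i' i'I|].
    by rewrite mnm1E; case: eqP i'I => // <-; rewrite iI.
  rewrite msuppC; case: eqP => // _; rewrite inE => /eqP -> i' _.
  exact: mnm0E.
exists (\row_i if i \in I then `|u 0 i - q 0 i| + 1 else 0).
  by apply/forallP => i; apply/implyP => /negbTE iI; rewrite mxE iI.
move=> a /forallP aI va.
have aI0 i : i \notin I -> a 0 i = 0.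
  by move=> iI; have /implyP /(_ iI) /eqP := aI i.
have aI1 i : i \in I -> `|u 0 i - q 0 i| + 1 <= a 0 i by move=> iI; have := va i; rewrite mxE iI.
have aNI : in_NI I a.
  apply/forallP => i; case: ifP => [/aI1|/negbT /aI0 -> //].
  by apply: le_trans; rewrite addr_ge0.
rewrite /restriction aNI /basic_series /restricted_basic_poly mevalZ.
rewrite (bigID (mem I)) /= [X in X%:~R = _]mulrC intrM; congr (_ * _).
  by congr (_%:~R); apply: eq_bigr => i iI; rewrite mxE aI0 // addr0.
rewrite !rmorph_prod /=; apply: eq_bigr => i iI.
rewrite (@invpow_polyE _ _ _ _ (a 0 i)) //.
  by rewrite mxE; congr (invpow_coef _ _)%:~R; ring.
by have := aI1 _ iI; move: (a 0 i) (_ - _) => x y; lia.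
Qed.

Lemma decomposable_hilbert m (H : zseries n) u I : decomposable m H ->
  exists2 p, is_hilbert_polynomial I (restriction H I u) p &
    has_positive_extremal_coefficients p.
Proof.
move=> [s _ /funext ->]; exists (\sum_(qz <- s) restricted_basic_poly I u qz.1 qz.2).
  have -> : restriction (decomposition s) I u =
      fun a => \sum_(qz <- s) restriction (basic_series qz.1 qz.2) I u a.
    apply/funext => a; rewrite /restriction; case: ifP => // _.
    by rewrite big1.
  by apply: hilbert_polynomial_sum => qz; apply: hilbert_polynomial_basic.
by apply: sum_positive_top => qz _; apply: restricted_basic_poly_top.
Qed.

End HilbertPolynomials.

(** * Absolute monotonicity of polynomials with positive extremal coefficients *)

Definition fdiff_seq n (V : zmodType) (js : seq 'I_n) (F : zvec n -> V) : zvec n -> V :=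
  foldl (fun G j => fdiff j G) F js.

Section AbsolutelyMonotone.
Variables (n : nat) (I : {set 'I_n}).
Implicit Types (f g : zvec n -> rat) (x : zvec n) (p q : {mpoly rat[n]}).

(** All iterated forward differences are nonnegative on the region x_i >= V, i in I. In
contrast to nonnegativity of the values, this property passes to differences with the
same V, and it is stable under sums and products. *)
Definition abs_monotone (V : nat) f :=
  forall js x, (forall i, i \in I -> V%:Z <= x 0 i) -> 0 <= fdiff_seq js f x.

Lemma fdiff_seqD js f g :
  fdiff_seq js (fun x => f x + g x) = fun x => fdiff_seq js f x + fdiff_seq js g x.
Proof.
elim: js f g => //= j js IH f g; rewrite -IH; congr fdiff_seq.
by apply/funext => x; rewrite /fdiff; ring.
Qed.

Lemma fdiff_seq_shift js f b :
  fdiff_seq js (fun x => f (x + b)) = fun x => fdiff_seq js f (x + b).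
Proof.
elim: js f => //= j js IH f; rewrite -IH; congr fdiff_seq.
by apply/funext => x; rewrite /fdiff addrAC.
Qed.

Lemma region_step (V : int) x j : (forall i, i \in I -> V <= x 0 i) ->
  forall i, i \in I -> V <= (x + evec j) 0 i.
Proof. by move=> Vx i /Vx; rewrite add_evecE; case: (_ == _) => /=; lia. Qed.

Lemma abs_monotoneW (V W : nat) f : (V <= W)%N -> abs_monotone V f -> abs_monotone W f.
Proof.
by move=> VW mf js x Wx; apply: mf => i /Wx; apply: le_trans; rewrite lez_nat.
Qed.

Lemma abs_monotoneD V f g : abs_monotone V f -> abs_monotone V g ->
  abs_monotone V (fun x => f x + g x).
Proof. by move=> mf mg js x Vx; rewrite fdiff_seqD addr_ge0 ?mf ?mg. Qed.

(** By the product rule D(f g) = D f * g(. + e_j) + f * D g, in which all four factors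
are again absolutely monotone. *)
Lemma abs_monotoneM V f g : abs_monotone V f -> abs_monotone V g ->
  abs_monotone V (fun x => f x * g x).
Proof.
move=> mf mg js; elim: js f g mf mg => [|j js IH] f g mf mg x Vx /=.
  by rewrite mulr_ge0 ?(mf [::]) ?(mg [::]).
have -> : fdiff j (fun y => f y * g y) =
    fun y => fdiff j f y * g (y + evec j) + f y * fdiff j g y.
  by apply/funext => y; rewrite /fdiff; ring.
rewrite fdiff_seqD addr_ge0 // IH //.
- by move=> js'; apply: (mf (j :: js')).
- by move=> js' y Vy; rewrite fdiff_seq_shift; apply/mg/region_step.
- by move=> js'; apply: (mg (j :: js')).
Qed.

Lemma fdiff_seq0 js : fdiff_seq js (fun=> 0) = (fun=> 0 : rat) :> (zvec n -> rat).
Proof.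
by elim: js => //= j js IH; rewrite -[RHS]IH; congr fdiff_seq.
Qed.

Lemma abs_monotoneC V c : 0 <= c -> abs_monotone V (fun=> c).
Proof.
move=> c0 [|j js] x _ //=.
have -> : fdiff j (fun=> c) = (fun=> 0) by apply/funext => y; rewrite /fdiff subrr.
by rewrite fdiff_seq0.
Qed.

Definition poly_fun p : zvec n -> rat := fun x => p.@[fun i => (x 0 i)%:~R].

Lemma abs_monotone_polyM V p q : abs_monotone V (poly_fun p) -> abs_monotone V (poly_fun q) ->
  abs_monotone V (poly_fun (p * q)).
Proof.
move=> mp mq; have := abs_monotoneM mp mq.
by congr abs_monotone; apply/funext => x; rewrite /poly_fun mevalM.
Qed.

Lemma abs_monotone_polyD V p q : abs_monotone V (poly_fun p) -> abs_monotone V (poly_fun q) ->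
  abs_monotone V (poly_fun (p + q)).
Proof.
move=> mp mq; have := abs_monotoneD mp mq.
by congr abs_monotone; apply/funext => x; rewrite /poly_fun mevalD.
Qed.

Lemma abs_monotone_polyC V c : 0 <= c -> abs_monotone V (poly_fun c%:MP).
Proof.
move=> /abs_monotoneC - /(_ V); congr abs_monotone.
by apply/funext => x; rewrite /poly_fun mevalC.
Qed.

Lemma abs_monotone_polyZ V c p : 0 <= c -> abs_monotone V (poly_fun p) -> abs_monotone V (poly_fun (c *: p)).
Proof. by move=> c0; rewrite -mul_mpolyC; apply/abs_monotone_polyM/abs_monotone_polyC. Qed.

Lemma abs_monotone_polyX V (l : 'X_{1..n}) : (forall i, i \notin I -> l i = 0%N) ->
  abs_monotone V (poly_fun 'X_[l]).
Proof.
have m1 : abs_monotone V (poly_fun 1) by rewrite -mpolyC1; apply: abs_monotone_polyC.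
move=> lI; rewrite mpolyXE_id; apply: (big_ind (fun p => abs_monotone V (poly_fun p))) => // [|i _]; first exact: abs_monotone_polyM.
have [iI|/lI -> //] := boolP (i \in I).
elim: (l i) => [|k IH]; rewrite ?expr0 // exprS; apply: abs_monotone_polyM => // {IH}.
have -> : poly_fun 'X_i = fun x => (x 0 i)%:~R by apply/funext => x; rewrite /poly_fun mevalXU.
case=> [|j js] x Vx /=; first by rewrite ler0z; apply: le_trans (Vx i iI).
have -> : fdiff j (fun y : zvec n => (y 0 i)%:~R) = (fun=> (i == j)%:Z%:~R : rat).
  by apply/funext => y; rewrite /fdiff add_evecE rmorphD /= addrAC subrr add0r.
by apply: (@abs_monotoneC V) => //; rewrite ler0z.
Qed.

Lemma monomial_ge V (l : 'X_{1..n}) x : (forall i, i \notin I -> l i = 0%N) -> l != 0%MM ->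
  (0 < V)%N -> (forall i, i \in I -> V%:Z <= x 0 i) -> V%:R <= poly_fun 'X_[l] x.
Proof.
move=> lI l0 V0 Vx; rewrite /poly_fun mevalX.
have [i li] : exists i, l i != 0%N.
  apply/existsP; apply: contraNT l0 => /existsPn l0; apply/eqP/mnmP => i.
  by rewrite mnm0E; apply/eqP; rewrite -[_ == _]negbK l0.
have iI : i \in I by apply: contraNT li => /lI ->.
have ge1 j : j \in I -> 1 <= (x 0 j)%:~R :> rat.
  by move=> /Vx Vj; rewrite ler1z; apply: le_trans Vj; rewrite lez_nat.
have V0' : V%:R <= (x 0 i)%:~R :> rat by rewrite pmulrn ler_int Vx.
rewrite (bigD1 i) //= -[V%:R]mulr1 ler_pM //.
  apply: le_trans V0' _; rewrite -(prednK (n := l i)) ?lt0n // exprS.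
  by rewrite ler_peMr ?exprn_ege1 ?(le_trans ler01) ?ge1.
elim/big_ind: _ => // [a b a1 b1|j _]; first by rewrite mulr_ege1.
by have [jI|/lI ->] := boolP (j \in I); rewrite ?expr0 // exprn_ege1 ?ge1.
Qed.

(** The constant d disappears in every proper difference, and the value itself is
nonnegative since the monomial is at least V on the region. *)
Lemma abs_monotone_dominated V (l : 'X_{1..n}) c d :
  (forall i, i \notin I -> l i = 0%N) -> l != 0%MM -> (0 < V)%N -> 0 < c ->
  `|d| <= c * V%:R -> abs_monotone V (poly_fun (c *: 'X_[l] + d%:MP)).
Proof.
move=> lI l0 V0 c0 dV [|j js] x Vx /=.
  rewrite /poly_fun mevalD mevalC mevalZ.
  have := monomial_ge lI l0 V0 Vx; rewrite /poly_fun -(ler_pM2l c0) => le1.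
  by have := lerNnormlW (lexx `|d|); lra.
have -> : fdiff j (poly_fun (c *: 'X_[l] + d%:MP)) = fdiff j (poly_fun (c *: 'X_[l])).
  by apply/funext => y; rewrite /fdiff /poly_fun !mevalD !mevalC; ring.
apply: (abs_monotone_polyZ (V := V) (ltW c0) (abs_monotone_polyX lI) (j :: js)) Vx.
Qed.

Lemma abs_monotone_sum (J : eqType) (r : seq J) (F : J -> {mpoly rat[n]}) :
  (forall j, j \in r -> exists V, abs_monotone V (poly_fun (F j))) ->
  exists V, abs_monotone V (poly_fun (\sum_(j <- r) F j)).
Proof.
elim: r => [|j r IH] mF.
  by exists 0%N; rewrite big_nil -(mpolyC0 n rat); apply: abs_monotone_polyC.
have [|V mV] := IH; first by move=> i ir; apply: mF; rewrite inE ir orbT.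
have [W mW] := mF j (mem_head _ _); exists (maxn V W); rewrite big_cons.
by apply: abs_monotone_polyD;
  [apply: abs_monotoneW mW; rewrite leq_maxr | apply: abs_monotoneW mV; rewrite leq_maxl].
Qed.

Lemma exists_extremal p l : l \in msupp p ->
  exists2 e, extremal p e & (l <= e)%MM.
Proof.
move=> lp; pose s := [seq k <- msupp p | (l <= k)%MM].
have ls : l \in s by rewrite mem_filter lepm_refl.
have [e] := seq_argmax mdeg ls; rewrite mem_filter => /andP [le ep] emax.
exists e => //; split=> // k kp ek.
have : k \in s by rewrite mem_filter kp (lepm_trans le ek).
move=> /emax; rewrite -{1}(submK ek) mdegD -[X in (_ <= X)%N]add0n leq_add2r leqn0.
by rewrite mdeg_eq0 => /eqP d0; rewrite -(submK ek) d0 add0m.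
Qed.

(** A nonextremal monomial l properly divides an extremal one e, and
p_l Z^l + p_e Z^e = Z^l (p_e Z^(e - l) + p_l) is absolutely monotone far out by
[abs_monotone_dominated]. To let one extremal monomial serve several nonextremal
ones, p is multiplied by its number N of terms: N p is the sum over the terms l
of N p_l Z^l, present only if l is not extremal, plus the whole extremal part. *)
Lemma positive_extremal_abs_monotone p : mpoly_in I p ->
  has_positive_extremal_coefficients p -> exists V, abs_monotone V (poly_fun p).
Proof.
move=> pI pos.
pose N : rat := (size (msupp p))%:R.
pose E := [seq e <- msupp p | `[< extremal p e >]].
have EP e : e \in E -> [/\ e \in msupp p, extremal p e & 0 < p@_e].
  by rewrite mem_filter => /andP [/asboolP ee ep]; split=> //; apply: pos.
pose top := \sum_(e <- E) p@_e *: 'X_[e].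
pose q l := (if `[< extremal p l >] then 0 else (N * p@_l) *: 'X_[l]) + top.
have mX e : e \in E -> abs_monotone 0 (poly_fun (p@_e *: 'X_[e])).
  case/EP=> ep _ /ltW e0; apply: abs_monotone_polyZ => //.
  by apply: abs_monotone_polyX; apply: pI.
have mq l : l \in msupp p -> exists V, abs_monotone V (poly_fun (q l)).
  move=> lp; rewrite /q; case: asboolP => [_|nl].
    by rewrite add0r; apply: abs_monotone_sum => e /mX; exists 0%N.
  have [e ee le] := exists_extremal lp.
  have eE : e \in E by rewrite mem_filter ee.1 andbT; apply/asboolP.
  have [_ _ e0] := EP e eE.
  have [W mW] : exists W, abs_monotone W (poly_fun (\sum_(f <- rem e E) p@_f *: 'X_[f])).
    by apply: abs_monotone_sum => f /mem_rem /mX; exists 0%N.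
  set b := Num.bound (`|N * p@_l| / p@_e).
  exists (maxn W b.+1); rewrite /top (big_rem _ eE) /= addrA.
  apply: abs_monotone_polyD; last by apply: abs_monotoneW mW; rewrite leq_maxl.
  have -> : (N * p@_l) *: 'X_[l] + p@_e *: 'X_[e] =
      'X_[l] * (p@_e *: 'X_[e - l] + (N * p@_l)%:MP) :> {mpoly rat[n]}.
    rewrite mulrDr -scalerAr -mpolyXD addmC submK // addrC; congr (_ + _).
    by rewrite [RHS]mulrC mul_mpolyC.
  apply: abs_monotone_polyM; first by apply: abs_monotone_polyX; apply: pI.
  apply: abs_monotone_dominated; rewrite ?leq_max ?orbT //.
  - by move=> i iI; rewrite mnmBE (pI e ee.1).
  - apply/eqP => el0; apply: nl.
    by rewrite -[l]add0m -el0 submK.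
  - rewrite [leRHS]mulrC -ler_pdivrMr //.
    have ge0 : 0 <= `|N * p@_l| / p@_e by rewrite divr_ge0 // ltW.
    apply: le_trans (ltW (archi_boundP ge0)) _.
    by rewrite ler_nat leq_max leqnSn orbT.
have [V mV] := abs_monotone_sum mq.
have [p0|p0] := eqVneq p 0.
  by exists 0%N; rewrite p0 -(mpolyC0 n rat); apply: abs_monotone_polyC.
have N0 : 0 < N by rewrite ltr0n lt0n size_eq0 msupp_eq0.
exists V; have -> : p = N^-1 *: \sum_(l <- msupp p) q l.
  have Np : \sum_(l <- msupp p) q l = N *: p.
    rewrite big_split /= big_const_seq count_predT iter_addr addr0 -scaler_nat.
    rewrite [in RHS](mpolyE p) [in RHS](bigID (fun l => `[< extremal p l >])) /=.
    rewrite addrC scalerDr /top big_filter; congr (_ + _).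
    rewrite scaler_sumr big_mkcond [in RHS]big_mkcond /=; apply: eq_bigr => l _.
    by case: asboolP; rewrite ?scalerA.
  by rewrite Np scalerA mulVf ?scale1r // gt_eqF.
by apply: abs_monotone_polyZ mV; rewrite invr_ge0 ltW.
Qed.

End AbsolutelyMonotone.

(** * From Hilbert polynomials to decompositions *)

Section Newton.
Variables (n : nat) (m : 'I_n -> nat).
Implicit Types (F H : zseries n) (x s u : zvec n) (I J : {set 'I_n}).

(** Newton's forward formula, truncated at the order k of the vanishing difference. *)
Lemma newton_expansion F j (c : int) k x t :
  (forall y : zvec n, c <= y 0 j -> iter k (fdiff j) F y = 0) -> c <= x 0 j ->
  F (x + t%:Z *: evec j) = \sum_(i < k) 'C(t, i)%:Z * iter i (fdiff j) F x.
Proof.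
elim: t F => [|t IH] F F0 cx.
  rewrite scale0r addr0; case: k F0 => [|k] F0; first by rewrite big_ord0 [LHS]F0.
  by rewrite big_ord_recl bin0 mul1r big1 ?addr0 // => i _; rewrite bin0n mul0r.
have -> : F (x + t.+1%:Z *: evec j) = F (x + t%:Z *: evec j) + fdiff j F (x + t%:Z *: evec j).
  by rewrite /fdiff [RHS]addrC subrK; congr F; apply/rowP => i; rewrite !mxE; lia.
rewrite !IH // => [|y cy]; last by rewrite -iterSr iterS /fdiff !F0 ?subrr // add_evecE eqxx; lia.
case: k F0 {IH} => [|k] F0; first by rewrite !big_ord0.
rewrite [in X in _ + X]big_ord_recr /= -iterSr F0 // mulr0 addr0.
rewrite big_ord_recl [RHS]big_ord_recl !bin0 -addrA; congr (_ + _).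
rewrite -big_split; apply: eq_bigr => i _ /=.
by rewrite /bump /= !add1n -iterSr binS PoszD mulrDl.
Qed.

Lemma iter_fdiff0 (P : zvec n -> Prop) F j k :
  (forall x, P x -> P (x + evec j)) -> (forall x, P x -> F x = 0) ->
  forall x, P x -> iter k (fdiff j) F x = 0.
Proof.
move=> Pj; elim: k F => //= k IH F F0 x Px.
by rewrite /fdiff !(IH _ F0) ?subrr //; apply: Pj.
Qed.

Definition splice J x s : zvec n := \row_i if i \in J then x 0 i else s 0 i.

(** Newton's formula in all directions of J, applied one direction at a time. The
directions outside J have been expanded already: they carry a factor
t_i^(q_i) / (1 - t_i)^(z_i), and in these F is evaluated at s only. *)
Lemma newton_decomposable J s F (q : zvec n) (z : 'X_{1..n}) :
  (forall i, i \notin J -> z i <= m i)%N ->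
  (forall js, all (mem J) js -> 0 <= fdiff_seq js F s) ->
  (forall i x, i \in J -> s 0 i <= x 0 i -> iter (m i) (fdiff i) F x = 0) ->
  decomposable m (fun x => (\prod_i (if i \in J then (s 0 i <= x 0 i)%R%:Z
     else invpow_coef (z i) (x 0 i - q 0 i))) * F (splice J x s)).
Proof.
have [t] := ubnP #|J|; elim: t J F q z => // t IH J F q z ltJ zm pos van.
have [J0|[j jJ]] := set_0Vmem J.
  have zm' i : (z i <= m i)%N by apply: zm; rewrite J0 inE.
  apply: decomposable_ext (decomposable_muln (pos [::] isT) (decomposable_basic q zm')) => x /=.
  rewrite mulrC J0; congr (_ * F _); last by apply/rowP => i; rewrite mxE inE.
  by apply: eq_bigr => i _; rewrite inE.
(* The term of order k in direction j is t_j^(s_j + k) / (1 - t_j)^(k + 1). *)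
pose q' k : zvec n := \row_i if i == j then s 0 j + k%:Z else q 0 i.
pose z' k := [multinom if i == j then k.+1 else z i | i < n].
have dk (k : 'I_(m j)) : decomposable m (fun x =>
    (\prod_i (if i \in J :\ j then (s 0 i <= x 0 i)%R%:Z
     else invpow_coef (z' k i) (x 0 i - q' k 0 i))) *
     iter k (fdiff j) F (splice (J :\ j) x s)).
  apply: IH.
  - by move: ltJ; rewrite (cardsD1 j) jJ.
  - move=> i; rewrite !inE negb_and negbK mnmE; case: eqP => [-> _|_ /=]; first exact: ltn_ord.
    exact: zm.
  - move=> js jsJ.
    have -> : fdiff_seq js (iter k (fdiff j) F) = fdiff_seq (nseq k j ++ js) F.
      rewrite /fdiff_seq foldl_cat; congr foldl; elim: (k : nat) F {pos van} => //= k' IHk F.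
      by rewrite -IHk -iterSr.
    apply: pos; rewrite all_cat all_nseq /= jJ orbT.
    by apply: sub_all jsJ => i /=; rewrite inE => /andP [].
  - move=> i x; rewrite !inE => /andP [ij iJ] sx; rewrite iter_fdiffC.
    apply: (@iter_fdiff0 (fun x => s 0 i <= x 0 i)) sx => y sy; last exact: van.
    by rewrite add_evecE (negbTE ij) addr0.
apply: decomposable_ext (decomposable_sum (index_enum _) dk) => x /=.
have [xj|xj] := leP (s 0 j) (x 0 j); last first.
  rewrite big1 => [|k _]; rewrite (bigD1 j) //=.
    by rewrite jJ leNgt xj !mul0r.
  by rewrite !inE eqxx mnmE mxE eqxx invpow_coef_neg ?mul0r //; lia.
have -> : splice J x s = splice (J :\ j) x s + `|x 0%R j - s 0%R j|%N%:Z *: evec j.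
  apply/rowP => i; rewrite add_scale_evecE !mxE !inE; case: eqP => [->|_]; rewrite ?addr0 //=.
  by rewrite jJ; lia.
rewrite (@newton_expansion _ _ (s 0 j) (m j)) => [|y sy|]; last 2 first.
- exact: van.
- by rewrite mxE !inE eqxx.
rewrite big_distrr; apply: eq_bigr => k _ /=; rewrite mulrA; congr (_ * _).
rewrite (bigD1 j) //= [in RHS](bigD1 j) //= mulrAC.
rewrite !inE eqxx /= jJ xj mnmE mxE eqxx mul1r; congr (_ * _).
  rewrite -invpow_coef_bin; congr invpow_coef.
  lia.
by apply: eq_bigr => i ij; rewrite !inE ij mnmE mxE (negbTE ij).
Qed.

End Newton.

Section FromHilbertPolynomials.
Variables (n : nat) (m : 'I_n -> nat) (H : zseries n).
Implicit Types (x s u : zvec n) (I J : {set 'I_n}).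

Definition orthant_part I u : zseries n := fun x => if in_NI I (x - u) then H x else 0.

Lemma in_NI_split I i (x : zvec n) : i \in I ->
  in_NI I x = in_NI (I :\ i) x (+) in_NI I (x - evec i).
Proof.
move=> iI; rewrite /in_NI.
have sp J (y : zvec n) : [forall j, if j \in J then 0 <= y 0 j else y 0 j == 0] =
    (if i \in J then 0 <= y 0 i else y 0 i == 0) &&
    [forall j, (j != i) ==> (if j \in J then 0 <= y 0 j else y 0 j == 0)].
  apply/forallP/andP => [h|[h /forallP h'] j]; last first.
    by have [->|ji] := eqVneq j i; [|have /implyP := h' j; apply].
  by split; [apply: h | apply/forallP => j; rewrite h implybT].
rewrite !sp iI !inE eqxx /= sub_evecE eqxx.
set B := [forall j, (j != i) ==> (if j \in I then 0 <= x 0 j else x 0 j == 0)].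
have -> : [forall j, (j != i) ==> (if j \in I :\ i then 0 <= x 0 j else x 0 j == 0)] = B.
  by apply: eq_forallb => j; rewrite !inE; case: eqP.
have -> : [forall j, (j != i) ==>
    (if j \in I then 0 <= (x - evec i) 0 j else (x - evec i) 0 j == 0)] = B.
  by apply: eq_forallb => j; rewrite sub_evecE; case: eqP => //= _; rewrite subr0.
case: B; rewrite ?andbF ?andbT //.
by move: (x 0 i) => y; lia.
Qed.

(** u + N^I is the disjoint union of its facet x_i = u_i and of u + e_i + N^I. *)
Lemma orthant_part_step I u i : i \in I ->
  decomposable m (orthant_part (I :\ i) u) -> decomposable m (orthant_part I (u + evec i)) ->
  decomposable m (orthant_part I u).
Proof.
move=> iI d1 d2; apply: decomposable_ext (decomposableD d1 d2) => x.
rewrite /orthant_part opprD addrA (in_NI_split (x - u) iI).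
case E: (in_NI (I :\ i) _); case E': (in_NI I _); rewrite ?addr0 ?add0r //.
have /forallP /(_ i) := E; have /forallP /(_ i) := E'.
rewrite iI !inE eqxx /= sub_evecE eqxx => h /eqP h'; rewrite h' in h.
by move: h; rewrite sub0r.
Qed.

Hypothesis top_fdiff0 : exists N : int, forall i x, N <= x 0 i -> iter (m i) (fdiff i) H x = 0.
Hypothesis hilbert_pos : forall u I, exists2 p : {mpoly rat[n]},
  is_hilbert_polynomial I (restriction H I u) p & has_positive_extremal_coefficients p.

(** Newton expansion at a point so far out that H agrees with its Hilbert polynomial from
there on, that this polynomial is absolutely monotone there, and that the differences
of order m_i vanish. *)
Lemma orthant_part_far I u :
  exists t : nat, decomposable m (orthant_part I (u + \row_i if i \in I then t%:Z else 0)).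
Proof.
have [N HN] := top_fdiff0; have [p [pI [v vI pH]] ppos] := hilbert_pos u I.
have [V mV] := positive_extremal_abs_monotone pI ppos.
pose t := (V + \sum_i (`|v 0%R i| + `|N - u 0%R i|))%N.
exists t; set s := u + _.
have tle i : (`|v 0%R i| + `|(N - u 0 i)%R| <= t)%N /\ (V <= t)%N.
  by rewrite leq_addr; split=> //; rewrite /t (bigD1 i) //= addnCA leq_addr.
have sI i : i \in I -> s 0 i = u 0 i + t%:Z by rewrite !mxE => ->.
have snI i : i \notin I -> s 0 i = u 0 i by rewrite !mxE => /negbTE ->; rewrite addr0.
pose P x := in_ZI I (x - u) /\ forall i, i \in I -> s 0 i <= x 0 i.
have Pstep x j : j \in I -> P x -> P (x + evec j).
  move=> jI [/forallP zx sx]; split=> [|i iI]; last first.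
    by rewrite add_evecE; have := sx i iI; case: (_ == _) => /=; lia.
  apply/forallP => i; apply/implyP => iI; rewrite addrAC add_evecE.
  have /implyP /(_ iI) /eqP -> := zx i; rewrite add0r.
  by case: (eqVneq i j) iI => // ->; rewrite jI.
have HP x : P x -> (H x)%:~R = poly_fun p (x - u).
  move=> [xI sx]; rewrite /poly_fun -pH //.
    rewrite /restriction (addrC u) subrK.
    suff -> : in_NI I (x - u) by [].
    apply/forallP => i; case: ifP => [iI|/negbT iI].
      by have := sx i iI; rewrite sI // !mxE; move: (x 0 i) (u 0 i) => a b; lia.
    by have /forallP /(_ i) /implyP /(_ iI) := xI.
  move=> i; have [iI|iI] := boolP (i \in I).
    have := sx i iI; rewrite sI // !mxE; have [] := tle i.
    by move: (v 0 i) (x 0 i) (u 0 i) => a b c; lia.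
  have /forallP /(_ i) /implyP /(_ iI) /eqP -> := xI.
  by have /forallP /(_ i) /implyP /(_ iI) /eqP -> := vI.
(* Forward differences in the directions of I stay in the region P. *)
have HPs js : all (mem I) js -> forall (F : zvec n -> int) (G : zvec n -> rat),
    (forall x, P x -> (F x)%:~R = G (x - u)) ->
    forall x, P x -> (fdiff_seq js F x)%:~R = fdiff_seq js G (x - u).
  elim: js => [|j js IH] //= /andP [jI jsI] F G FG; apply: IH => // x Px.
  rewrite /fdiff rmorphB /= !FG //; last exact: Pstep.
  by congr (G _ - _); rewrite addrAC.
have Ps : P s.
  split=> //; apply/forallP => i; apply/implyP => iI.
  by rewrite !mxE (negbTE iI) addr0 subrr.
have nd : decomposable m (fun x => (\prod_i (if i \in I then (s 0 i <= x 0 i)%R%:Z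
     else invpow_coef (0%MM i) (x 0 i - u 0 i))) * H (splice I x s)).
  apply: newton_decomposable.
  - by move=> i _; rewrite mnm0E.
  - move=> js jsI; rewrite -(ler0z rat) (HPs js jsI _ _ HP s Ps); apply: mV => i iI.
    rewrite !mxE iI; have [_] := tle i.
    by move: (u 0 i) => a; lia.
  - move=> i x iI sx; apply: HN; apply: le_trans sx; rewrite sI //.
    by have [] := tle i; move: (v 0 i) (u 0 i) => a b; lia.
apply: decomposable_ext nd => x; rewrite /orthant_part /in_NI.
case: forallP => [all|nall].
  rewrite big1 => [|i _].
    rewrite mul1r; congr H; apply/rowP => i; rewrite mxE; case: ifP => // /negbT iI.
    by have := all i; rewrite (negbTE iI) 2!mxE subr_eq0 => /eqP.
  have := all i; case: ifP => [iI|/negbT iI]; rewrite 2!mxE.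
    by rewrite subr_ge0 => ->.
  by rewrite mnm0E /= snI // => ->.
have [i ni] : exists i, ~~ (if i \in I then 0 <= (x - s) 0 i else (x - s) 0 i == 0).
  by apply/existsP; apply: contrapT => /negP /existsPn h; apply: nall => i; move: (h i); rewrite negbK.
rewrite (bigD1 i) //=; move: ni; case: ifP => [iI|/negbT iI]; rewrite 2!mxE.
  by rewrite subr_ge0 => /negbTE ->; rewrite !mul0r.
by rewrite mnm0E /= snI // => /negbTE ->; rewrite !mul0r.
Qed.

(** Induction on the dimension of the orthant, descending from the far point
to u by steps of unit length, each of which adds a facet. *)
Lemma orthant_part_decomposable I u : decomposable m (orthant_part I u).
Proof.
have [k] := ubnP #|I|; elim: k I u => // k IH I u ltI.
have [t dt] := orthant_part_far I u.
have desc (l : seq 'I_n) : all (mem I) l -> forall u',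
    decomposable m (orthant_part I (u' + \sum_(i <- l) evec i)) ->
    decomposable m (orthant_part I u').
  elim: l => [|i l IHl] /=; first by move=> _ u'; rewrite big_nil addr0.
  move=> /andP [iI lI] u'; rewrite big_cons addrA => /(IHl lI).
  apply: orthant_part_step => //; apply: IH.
  by move: ltI; rewrite (cardsD1 i) iI.
(* Each direction of I is descended t times. *)
apply: (desc (flatten (nseq t (enum I)))).
  by apply/allP => i /flattenP [r /nseqP [-> _]]; rewrite mem_enum.
apply: decomposable_ext dt => x; congr (orthant_part I (u + _) x).
apply/rowP => i; rewrite mxE summxE big_flatten big_nseq iter_addr addr0 big_enum /=.
under eq_bigr do rewrite evecE.
case: ifP => iI; last first.
  rewrite big1 ?mul0rn // => j jI.
  by case: eqP => // ij; rewrite -ij iI in jI.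
rewrite (bigD1 i) //= eqxx big1 ?addr0; last by move=> j /andP [_ /negbTE]; rewrite eq_sym => ->.
by rewrite natz.
Qed.

Lemma hilbert_decomposable : is_laurent_series H -> decomposable m H.
Proof.
move=> [b bH]; apply: decomposable_ext (orthant_part_decomposable setT b) => x.
rewrite /orthant_part; case: ifP => // /negbT /forallPn [i].
rewrite inE 2!mxE subr_ge0 => bx; apply/esym/eqP; apply: contraNT bx => /bH; exact.
Qed.

End FromHilbertPolynomials.

(** * Counting exponents in sets closed under divisors *)

Local Notation leqs := (all2 leq).

Lemma leqs_refl s : leqs s s.
Proof. by elim: s => //= x s ->; rewrite leqnn. Qed.

Lemma leqs_trans s t r : leqs s t -> leqs t r -> leqs s r.
Proof.
elim: s t r => [|x s IH] [|y t] [|z r] //= /andP [xy st] /andP [yz tr].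
by rewrite (leq_trans xy yz) (IH t).
Qed.

Definition finite_basis (N : nat) (U : seq nat -> Prop) : Prop :=
  exists G : seq (seq nat), (forall g, g \in G -> U g) /\
    forall s, size s = N -> U s -> exists2 g, g \in G & leqs g s.

Definition dickson (N : nat) := forall U : seq nat -> Prop,
  (forall s t, leqs s t -> U s -> U t) -> finite_basis N U.

Definition down_closed (D : seq nat -> Prop) := forall s t, leqs s t -> D t -> D s.

(** The complements of the D x form an increasing chain of up-closed sets. Their union
has a finite basis, which already lies in one member of the chain. *)
Lemma dickson_stable N (D : nat -> seq nat -> Prop) : dickson N ->
  (forall x, down_closed (D x)) -> (forall x y s, (x <= y)%N -> D y s -> D x s) ->
  exists x0, forall x s, size s = N -> (x0 <= x)%N -> D x0 s -> D x s.
Proof.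
move=> dN down decr.
have [s t st [x nD]|G [GU Gb]] := dN (fun s => exists x, ~ D x s).
  by exists x => Dt; apply: nD; apply: down st Dt.
have [x0 x0G] : exists x0, forall g, g \in G -> ~ D x0 g.
  elim: G GU {Gb} => [|g G IH] GU; first by exists 0%N.
  have [|x0 x0G] := IH; first by move=> h hG; apply: GU; rewrite inE hG orbT.
  have [y yg] := GU g (mem_head _ _); exists (maxn x0 y) => h.
  rewrite inE => /predU1P [->|/x0G nh] /decr D0; [apply: yg|apply: nh]; apply: D0.
    by rewrite leq_maxr.
  by rewrite leq_maxl.
exists x0 => x s sN _ D0; apply: contrapT => nDx.
have [|g /x0G ng gs] := Gb s sN; first by exists x.
by apply: ng; apply: down gs D0.
Qed.

(** The slices of an up-closed set by the first entry increase and so become constant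
by [dickson_stable] in one dimension less; bases of the slices up to that point,
put together, form a basis. *)
Lemma dickson_lemma N : dickson N.
Proof.
elim: N => [|N IH] U up.
  have [U0|nU0] := pselect (U [::]).
    exists [:: [::]]; split=> [g|s /size0nil -> _]; first by rewrite inE => /eqP ->.
    by exists [::]; rewrite ?inE.
  by exists [::]; split=> // s /size0nil -> /nU0.
have upx x : forall s t, leqs s t -> U (x :: s) -> U (x :: t).
  by move=> s t st; apply: up; rewrite /= leqnn.
have [x0 x0P] : exists x0, forall x s, size s = N -> (x0 <= x)%N ->
    ~ U (x0 :: s) -> ~ U (x :: s).
  apply: (dickson_stable IH) => [x s t /upx st nt /st //|x y s xy ny Ux].
  by apply: ny; apply: up Ux; rewrite /= xy leqs_refl.
have [G [GU Gb]] : exists G : seq (seq nat), (forall g, g \in G -> U g) /\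
    forall x s, (x <= x0)%N -> size s = N -> U (x :: s) -> exists2 g, g \in G & leqs g (x :: s).
  elim: (x0) => [|x1 [G [GU Gb]]].
    have [G [GU Gb]] := IH _ (upx 0%N); exists [seq 0%N :: g | g <- G]; split.
      by move=> _ /mapP [g /GU Ug ->].
    move=> x s; rewrite leqn0 => /eqP -> sN /(Gb s sN) [g gG gs].
    by exists (0%N :: g); rewrite ?map_f //= gs.
  have [G' [GU' Gb']] := IH _ (upx x1.+1); exists (G ++ [seq x1.+1 :: g | g <- G']); split.
    by move=> g; rewrite mem_cat => /orP [/GU //|/mapP [h /GU' Ug ->]].
  move=> x s; rewrite leq_eqVlt => /predU1P [-> sN /(Gb' s sN) [g gG gs]|xx1 sN Us].
    by exists (x1.+1 :: g); rewrite ?mem_cat ?map_f ?orbT //= leqnn gs.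
  by have [g gG gs] := Gb x s xx1 sN Us; exists g; rewrite ?mem_cat ?gG.
exists G; split=> // [[|x s]] //= [sN] Us.
have [xx0|x0x] := leqP x x0; first exact: Gb.
have U0 : U (x0 :: s) by apply: contrapT => /(x0P x s sN (ltnW x0x)).
have [g gG gs] := Gb x0 s (leqnn _) sN U0; exists g => //.
by apply: leqs_trans gs _; rewrite /= leqs_refl (ltnW x0x).
Qed.

Section WeightedCount.
Variable n : nat.
Implicit Types (cs : seq 'I_n) (a : zvec n) (s : seq nat).

(** The exponent sequences of degree a when the variables carry the labels cs, the degree
of a variable being the unit vector of its label. Recursion on the list of labels makes
every variable an additional summation. *)
Fixpoint seqs_of_deg cs a : seq (seq nat) :=
  if cs is c :: cs' then
    [seq x :: s | x <- iota 0 `|a 0%R c|.+1, s <- seqs_of_deg cs' (a - x%:Z *: evec c)]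
  else if a == 0 then [:: [::]] else [::].

Lemma seqs_of_deg_cons c cs a : seqs_of_deg (c :: cs) a =
  [seq x :: s | x <- iota 0 `|a 0%R c|.+1, s <- seqs_of_deg cs (a - x%:Z *: evec c)].
Proof. by []. Qed.

Fixpoint seq_deg cs s : zvec n :=
  match cs, s with
  | c :: cs', x :: s' => x%:Z *: evec c + seq_deg cs' s'
  | _, _ => 0
  end.

Lemma seq_deg_ge0 cs s i : 0 <= seq_deg cs s 0 i.
Proof.
elim: cs s => [|c cs IH] [|x s]; rewrite /= ?[(0 : 'M_(_, _)) _ _]mxE //.
by rewrite addrC add_scale_evecE addr_ge0 //; case: eqP.
Qed.

Lemma mem_seqs_of_deg cs a s : (s \in seqs_of_deg cs a) = (size s == size cs) && (seq_deg cs s == a).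
Proof.
elim: cs a s => [|c cs IH] a s.
  by rewrite /= size_eq0; case: s => [|x s]; rewrite eq_sym; case: eqP; rewrite ?inE.
apply/allpairsPdep/andP => [[x [t [_ tE ->]]]|].
  by move: tE; rewrite IH => /andP [/eqP tc /eqP td]; rewrite /= tc td addrC subrK !eqxx.
case: s => [|x s] [] //=; rewrite eqSS => sc /eqP da.
exists x, s; rewrite IH sc -da [_ + seq_deg _ _]addrC addrK eqxx; split=> //.
rewrite -[_ :: _]/(iota 0 _.+1) mem_iota add0n ltnS add_scale_evecE eqxx.
by have := seq_deg_ge0 cs s c; move: (seq_deg _ _ _ _) => y; lia.
Qed.

Lemma seqs_of_deg_uniq cs a : uniq (seqs_of_deg cs a).
Proof.
elim: cs a => [|c cs IH] a; first by rewrite /=; case: eqP.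
rewrite seqs_of_deg_cons; apply: allpairs_uniq_dep => [|x _|]; rewrite ?iota_uniq //.
by move=> [x s] [y t] _ _ /= [-> ->].
Qed.

Lemma seqs_of_deg_ge0 (D : pred (seq nat)) cs a i : (count D (seqs_of_deg cs a))%:Z != 0 -> 0 <= a 0 i.
Proof.
rewrite eqz_nat -lt0n -has_count => /hasP [s]; rewrite mem_seqs_of_deg => /andP [_ /eqP <-] _.
exact: seq_deg_ge0.
Qed.

Lemma count_seqs_of_deg_cons (D : pred (seq nat)) c cs a :
  (count D (seqs_of_deg (c :: cs) a))%:Z =
  \sum_(x < `|a 0%R c|.+1) (count (D \o cons (x : nat)) (seqs_of_deg cs (a - x%:Z *: evec c)))%:Z.
Proof.
rewrite seqs_of_deg_cons count_flatten sumnE !big_map.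
rewrite -(big_mkord xpredT (fun x => (count (D \o cons x) (seqs_of_deg cs (a - x%:Z *: evec c)))%:Z)).
rewrite /index_iota subn0.
rewrite (big_morph Posz PoszD (erefl 0)); apply: eq_bigr => x _.
by rewrite count_map.
Qed.

Lemma sum_vanish (F : nat -> int) X Y : (forall x, (X <= x)%N \/ (Y <= x)%N -> F x = 0) ->
  \sum_(x < X) F x = \sum_(x < Y) F x.
Proof.
have ext Z Z' : (Z <= Z')%N -> (forall x, (Z <= x)%N -> F x = 0) ->
    \sum_(x < Z) F x = \sum_(x < Z') F x.
  move=> ZZ' F0; rewrite -!(big_mkord xpredT F) (big_cat_nat (leq0n Z) ZZ') /= [X in _ + X]big1_seq ?addr0 //.
  by move=> x; rewrite mem_index_iota => /andP [_ /andP [/F0]].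
move=> F0; rewrite (ext X (maxn X Y)) ?(ext Y (maxn X Y)) ?leq_maxl ?leq_maxr // => x lex.
  by apply: F0; right.
by apply: F0; left.
Qed.

(** Slice D by the exponent x of the first variable. By Dickson's lemma the slices are
constant for x >= x0: the slices below x0 contribute finitely many shifted
decomposable series, and the constant slice contributes a shifted decomposable series
divided by 1 - t_c. *)
Lemma decomposable_down_closed cs (D : pred (seq nat)) : down_closed D ->
  decomposable (fun i => count_mem i cs) (fun a => (count D (seqs_of_deg cs a))%:Z).
Proof.
elim: cs D => [|c cs IH] D down.
  have [D0|nD0] := boolP (D [::]).
    apply: decomposable_ext (@decomposable_basic n (fun=> 0%N) 0 0%MM _) => [a|i]; last first.
      by rewrite mnm0E.
    by rewrite basic_series_exp0 /=; case: eqP => //= _; rewrite D0.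
  apply: decomposable_ext (decomposable0 _) => a /=.
  by case: eqP => //= _; rewrite (negbTE nD0).
have downx x : down_closed (D \o cons x).
  by move=> s t st; apply: down; rewrite /= leqnn.
pose f x := fun b => (count (D \o cons x) (seqs_of_deg cs b))%:Z.
have f0 x b : f x b != 0 -> 0 <= b 0 c by apply: seqs_of_deg_ge0.
have [x0 x0P] : exists x0, forall x s, size s = size cs -> (x0 <= x)%N ->
    D (x0 :: s) -> D (x :: s).
  apply: (dickson_stable (@dickson_lemma (size cs))) => [x|x y s xy]; first exact: downx.
  by apply: down; rewrite /= xy leqs_refl.
have fx0 x b : (x0 <= x)%N -> f x b = f x0 b.
  move=> x0x; congr Posz; apply: eq_in_count => s.
  rewrite mem_seqs_of_deg => /andP [/eqP sc _] /=; apply/idP/idP; last exact: x0P.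
  by apply: down; rewrite /= x0x leqs_refl.
pose g (b : zvec n) := \sum_(x < `|b 0%R c|.+1) f x0 (b - x%:Z *: evec c).
pose m' i := count_mem i (c :: cs).
have mm' i : (count_mem i cs + (i == c) <= m' i)%N by rewrite /m' /= addnC eq_sym.
have dg : decomposable m' (fun a => g (a - x0%:Z *: evec c)).
  apply/decomposable_shift/decomposable_cumul; [exact: mm'|exact: f0|exact: IH].
have df x : decomposable m' (f x).
  have [s sm sE] := IH _ (downx x); exists s => // qz /sm qzm i.
  exact: leq_trans (qzm i) (leq_trans (leq_addr _ _) (mm' i)).
have dh : decomposable m' (fun a => \sum_(x < x0) f x (a - x%:Z *: evec c)).
  by apply: decomposable_sum => x; apply: decomposable_shift.
apply: decomposable_ext (decomposableD dh dg) => a; rewrite count_seqs_of_deg_cons.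
set b := a - x0%:Z *: evec c.
have -> : g b = \sum_(y < `|b 0%R c|.+1) f (x0 + y)%N (a - (x0 + y)%N%:Z *: evec c).
  apply: eq_bigr => y _; rewrite fx0 ?leq_addr //; congr f.
  by rewrite PoszD scalerDl opprD addrA.
pose F x := f x (a - x%:Z *: evec c).
transitivity (\sum_(x < x0 + `|b 0%R c|.+1) F x); first by rewrite big_split_ord.
apply: (@sum_vanish F) => x; rewrite /F => xX; apply/eqP; apply: contraTT isT => /f0.
rewrite sub_scale_evecE eqxx; move: xX; rewrite /b sub_scale_evecE eqxx; move: (a 0 c) => y; lia.
Qed.

Lemma size_seqs_of_deg cs a :
  (size (seqs_of_deg cs a))%:Z = basic_series 0 [multinom count_mem i cs | i < n] a.
Proof.
elim: cs a => [|c cs IH] a.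
  have -> : [multinom count_mem i [::] | i < n] = 0%MM.
    by apply/mnmP => i; rewrite !mnmE.
  by rewrite basic_series_exp0 /=; case: eqP.
rewrite -count_predT count_seqs_of_deg_cons.
have -> : [multinom count_mem i (c :: cs) | i < n] =
    ([multinom count_mem i cs | i < n] + U_(c))%MM.
  by apply/mnmP => i; rewrite mnmDE !mnmE /= addnC.
rewrite -(@basic_series_sum _ _ _ _ _ `|a 0%R c|.+1); last first.
  by rewrite mxE subr0; move: (a 0 c) => y; lia.
by apply: eq_bigr => x _; rewrite -IH -count_predT.
Qed.

End WeightedCount.

Section Monomials.
Variables (n : nat) (m : 'I_n -> nat).
Local Notation N := (\sum_(i < n) m i)%N.
Implicit Types (k : 'X_{1..N}) (a : zvec n).

Lemma sum_tagnat (F : 'I_N -> nat) :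
  (\sum_x F x = \sum_(i < n) \sum_(j < m i) F (tagnat.Rank i j))%N.
Proof.
rewrite (reindex tagnat.rank); last exact/onW_bij/tagnat.rank_bij.
by rewrite sig_big_dep; apply: eq_bigr => p _; rewrite tagnat.rankE.
Qed.

Lemma sum_tagnat_fiber (F : 'I_N -> nat) i :
  (\sum_x (tagnat.sig1 x == i) * F x = \sum_(j < m i) F (tagnat.Rank i j))%N.
Proof.
rewrite sum_tagnat (bigD1 i) //= [X in (_ + X)%N]big1 ?addn0 => [|l li].
  by apply: eq_bigr => j _; rewrite tagnat.Rank1K eqxx mul1n.
by rewrite big1 // => j _; rewrite tagnat.Rank1K (negbTE li).
Qed.

(** The variable X_ij of R has label i; monomials of R are translated to
sequences of exponents in order to remove variables one at a time. *)
Definition labels : seq 'I_n := [seq tagnat.sig1 x | x <- enum 'I_N].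
Definition exponents k : seq nat := [seq k x | x <- enum 'I_N].
Definition mnm_of (s : seq nat) : 'X_{1..N} := [multinom nth 0%N s x | x < N].

Lemma count_labels i : count_mem i labels = m i.
Proof.
rewrite count_map -sum1_count big_mkcond big_enum_cond /=.
transitivity (\sum_(x < N) (tagnat.sig1 x == i) * 1)%N.
  by apply: eq_bigr => x _; rewrite muln1; case: eqP.
by rewrite (sum_tagnat_fiber (fun=> 1%N)) sum1_card card_ord.
Qed.

Lemma nth_exponents k (x : 'I_N) : nth 0%N (exponents k) x = k x.
Proof. by rewrite (nth_map x) ?size_enum_ord // nth_ord_enum. Qed.

Lemma size_exponents k : size (exponents k) = N.
Proof. by rewrite size_map size_enum_ord. Qed.

Lemma exponentsK k : mnm_of (exponents k) = k.
Proof. by apply/mnmP => x; rewrite mnmE nth_exponents. Qed.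

Lemma mnm_ofK s : size s = N -> exponents (mnm_of s) = s.
Proof.
move=> sN; apply: (@eq_from_nth _ 0%N); rewrite size_exponents // => x xN.
by rewrite -[x]/(val (Ordinal xN)) nth_exponents mnmE.
Qed.

Lemma seq_deg_exponents k : seq_deg labels (exponents k) = Xdeg k.
Proof.
apply/rowP => i; rewrite mxE.
have -> : seq_deg labels (exponents k) 0 i = (\sum_(x <- enum 'I_N) (tagnat.sig1 x == i) * k x)%N%:Z.
  rewrite /labels /exponents; elim: (enum _) => [|x l IH]; first by rewrite big_nil mxE.
  rewrite /= addrC add_scale_evecE IH big_cons PoszD addrC eq_sym.
  by case: eqP; rewrite ?mul1n ?mul0n.
by rewrite big_enum sum_tagnat_fiber.
Qed.

Definition monomials a : seq 'X_{1..N} := map mnm_of (seqs_of_deg labels a).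

Lemma mem_monomials k a : (k \in monomials a) = (Xdeg k == a).
Proof.
have sl : size labels = N by rewrite size_map size_enum_ord.
apply/mapP/eqP => [[s]|ka].
  rewrite mem_seqs_of_deg => /andP [/eqP ss /eqP <-] ->.
  by rewrite -seq_deg_exponents mnm_ofK // ss.
exists (exponents k); last by rewrite exponentsK.
by rewrite mem_seqs_of_deg size_exponents sl seq_deg_exponents ka !eqxx.
Qed.

Lemma monomials_uniq a : uniq (monomials a).
Proof.
have sl : size labels = N by rewrite size_map size_enum_ord.
rewrite map_inj_in_uniq ?seqs_of_deg_uniq // => s t.
rewrite !mem_seqs_of_deg => /andP [/eqP ss _] /andP [/eqP st _] e.
by rewrite -(mnm_ofK (etrans ss sl)) e mnm_ofK // st.
Qed.

Lemma decomposable_monomials (D : pred 'X_{1..N}) :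
  (forall k l, (k <= l)%MM -> D l -> D k) ->
  decomposable m (fun a => (count D (monomials a))%:Z).
Proof.
move=> down; have := @decomposable_down_closed n labels (D \o mnm_of).
have -> : (fun i => count_mem i labels) = m by apply/funext => i; apply: count_labels.
move=> dD; apply: decomposable_ext (dD _) => [a|s t st]; first by rewrite count_map.
apply: down; apply/mnm_lepP => x; rewrite !mnmE.
elim: s t (nat_of_ord x) st => [|y s IH] [|z t] [|j] //= /andP [yz st] //.
exact: IH.
Qed.

Lemma size_monomials a :
  (size (monomials a))%:Z = basic_series 0 [multinom m i | i < n] a.
Proof.
rewrite size_map size_seqs_of_deg; congr basic_series.
by apply/mnmP => i; rewrite !mnmE count_labels.
Qed.

End Monomials.

(** * Linear algebra over lists *)

Section Span.
Variables (A : nzRingType) (V : lmodType A).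
Implicit Types (s : seq V) (x y v : V).

(** Linear combinations by recursion on the list, which fits the
elimination process of [greedy]. *)
Fixpoint lspan s x : Prop :=
  if s is v :: s' then exists c : A, lspan s' (x - c *: v) else x = 0.

Lemma lspan0 s : lspan s 0.
Proof. by elim: s => //= v s IH; exists 0; rewrite scale0r subr0. Qed.

Lemma lspanZD s c x y : lspan s x -> lspan s y -> lspan s (c *: x + y).
Proof.
elim: s x y => [|v s IH] x y /=; first by move=> -> ->; rewrite scaler0 addr0.
move=> [a xa] [b yb]; exists (c * a + b).
have := IH _ _ xa yb; congr lspan.
by rewrite scalerBr scalerDl scalerA opprD addrACA.
Qed.

Lemma lspanD s x y : lspan s x -> lspan s y -> lspan s (x + y).
Proof. by move=> sx sy; rewrite -[x]scale1r; apply: lspanZD. Qed.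

Lemma lspanZ s c x : lspan s x -> lspan s (c *: x).
Proof. by move=> sx; rewrite -[_ *: _]addr0; apply: lspanZD => //; apply: lspan0. Qed.

Lemma lspan_sum (J : Type) (r : seq J) (P : pred J) (F : J -> V) s :
  (forall j, P j -> lspan s (F j)) -> lspan s (\sum_(j <- r | P j) F j).
Proof. by move=> sF; apply: (big_ind (lspan s)) => //; [apply: lspan0|apply: lspanD]. Qed.

Lemma mem_lspan s v : v \in s -> lspan s v.
Proof.
elim: s => //= w s IH; rewrite inE => /predU1P [->|/IH sv].
  by exists 1; rewrite scale1r subrr; apply: lspan0.
by exists 0; rewrite scale0r subr0.
Qed.

Lemma lspan_trans s s' x : (forall v, v \in s -> lspan s' v) -> lspan s x -> lspan s' x.
Proof.
elim: s x => [|v s IH] x /= ss'; first by move=> ->; apply: lspan0.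
move=> [c /IH xs']; rewrite -[x](subrK (c *: v)); apply: lspanD.
  by apply: xs' => w ws; apply: ss'; rewrite inE ws orbT.
by apply/lspanZ/ss'/mem_head.
Qed.

Lemma lspan_map s x (f : V -> V) : (forall c y z, f (y - c *: z) = f y - c *: f z) ->
  lspan s x -> lspan (map f s) (f x).
Proof.
move=> flin; have f0 : f 0 = 0.
  by have := flin 1 0 0; rewrite !scale1r !subrr.
by elim: s x => [|v s IH] x /= => [->|[c /IH]]; rewrite ?flin //; exists c.
Qed.

Lemma lspanP s x : lspan s x <-> exists c : 'I_(size s) -> A, x = \sum_i c i *: s`_i.
Proof.
elim: s x => [|v s IH] x /=.
  by split=> [->|[c ->]]; last rewrite big_ord0; first exists (fun=> 0); rewrite ?big_ord0.
split=> [[a /IH [c xc]]|[c ->]].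
  exists (fun i => if unlift ord0 i is Some j then c j else a).
  rewrite big_ord_recl unlift_none /= -[x](subrK (a *: v)) xc addrC; congr (_ + _).
  by apply: eq_bigr => i _; rewrite liftK.
exists (c ord0); apply/IH; exists (fun i => c (lift ord0 i)).
by rewrite big_ord_recl /= addrC addKr.
Qed.

Fixpoint lfree s : Prop := if s is v :: s' then ~ lspan s' v /\ lfree s' else True.

(** Gaussian elimination, run from the end of the list. *)
Fixpoint greedy s : seq V :=
  if s is v :: s' then
    if `[< lspan s' v >] then greedy s' else v :: greedy s'
  else [::].

Lemma greedy_sub s : {subset greedy s <= s}.
Proof.
elim: s => //= v s IH x; case: ifP => _; first by move=> /IH xs; rewrite inE xs orbT.
by rewrite !inE => /predU1P [->|/IH ->]; rewrite ?eqxx ?orbT.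
Qed.

Lemma greedy_span s x : lspan s x -> lspan (greedy s) x.
Proof.
apply: lspan_trans; elim: s {x} => //= v s IH x.
have tr y : lspan s y -> lspan (greedy s) y by apply: lspan_trans.
rewrite inE => /predU1P [->|/IH xs]; case: asboolP => // vs; first exact: tr.
  by apply: mem_lspan; rewrite mem_head.
by exists 0; rewrite scale0r subr0.
Qed.

Lemma greedy_free s : lfree (greedy s).
Proof.
elim: s => //= v s IH; case: asboolP => // nv /=; split=> // vs; apply: nv.
by apply: lspan_trans vs => w /greedy_sub; apply: mem_lspan.
Qed.

(** For vectors indexed by a strictly decreasing sequence, the vectors after v k in the
list are those of smaller index, so whether v k is kept can be decided from k
alone. *)
Lemma greedy_count d (T : orderType d) (v : T -> V) (ks : seq T) s :
  sorted >%O ks ->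
  size (greedy (map v ks ++ s)) =
  (count (fun k => ~~ `[< lspan (map v [seq l <- ks | (l < k)%O] ++ s) (v k) >]) ks
   + size (greedy s))%N.
Proof.
elim: ks => //= k ks IH; rewrite (path_sortedE (rev_trans lt_trans)) => /andP [/allP kgt sks].
rewrite ltxx.
have -> : [seq l <- ks | (l < k)%O] = ks.
  by rewrite -[RHS](filter_predT ks); apply: eq_in_filter => l /kgt.
have -> : count (fun k0 => ~~ `[< lspan (map v (if (k < k0)%O
      then k :: [seq l <- ks | (l < k0)%O] else [seq l <- ks | (l < k0)%O]) ++ s) (v k0) >]) ks =
    count (fun k0 => ~~ `[< lspan (map v [seq l <- ks | (l < k0)%O] ++ s) (v k0) >]) ks.
  by apply: eq_in_count => l /kgt lk /=; rewrite ltNge (ltW lk).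
by case: asboolP => _ /=; rewrite IH.
Qed.

End Span.

Section Dimension.
Variables (K : fieldType) (V : lmodType K).

Lemma lfreeP (s : seq V) (c : 'I_(size s) -> K) : lfree s ->
  \sum_i c i *: s`_i = 0 -> forall i, c i = 0.
Proof.
elim: s c => [|v s IH] c /=; first by move=> _ _ [].
move=> [nv fs]; rewrite big_ord_recl /= => e.
have c0 : c ord0 = 0.
  apply: contrapT => /eqP c0; apply: nv; apply/lspanP.
  exists (fun i => - (c ord0)^-1 * c (lift ord0 i)).
  apply: (scalerI c0); rewrite scaler_sumr; move/eqP: e; rewrite addr_eq0 => /eqP ->.
  rewrite -sumrN; apply: eq_bigr => i _.
  by rewrite scalerA mulrA mulrN divff // mulN1r scaleNr.
move: e; rewrite c0 scale0r add0r => /IH c's i.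
by have [j ->|->] := unliftP ord0 i; rewrite ?c's.
Qed.

Lemma independent_leq d d' (e : 'I_d -> V) (f : 'I_d' -> V) :
  (forall c : 'I_d' -> K, \sum_i c i *: f i = 0 -> forall i, c i = 0) ->
  (forall j, exists c : 'I_d -> K, f j = \sum_i c i *: e i) -> (d' <= d)%N.
Proof.
move=> free_f /choice [c fc]; rewrite leqNgt; apply/negP => ltd.
pose C : 'M[K]_(d', d) := \matrix_(j, i) c j i.
have : kermx C != 0.
  rewrite -mxrank_eq0 mxrank_ker -lt0n subn_gt0.
  by apply: leq_ltn_trans ltd; apply: rank_leq_col.
case/rowV0Pn => w /sub_kermxP wC w0; case/negP: w0; apply/eqP/rowP => j.
rewrite mxE; apply: (free_f (fun j => w 0 j)).
under eq_bigr do rewrite fc scaler_sumr.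
rewrite exchange_big big1 // => i _.
under eq_bigr do rewrite scalerA.
rewrite -scaler_suml; move/matrixP/(_ 0 i): wC; rewrite !mxE => e0.
rewrite (_ : \sum_j _ = 0) ?scale0r //; apply: etrans e0.
by apply: eq_bigr => l _; rewrite mxE.
Qed.

End Dimension.

(** Restriction of scalars to the constant polynomials. *)
Definition kmod (K : fieldType) (N : nat) (M : lmodType {mpoly K[N]}) : Type := M.

Section KMod.
Variables (K : fieldType) (N : nat) (M : lmodType {mpoly K[N]}).

HB.instance Definition _ := GRing.Zmodule.copy (kmod M) M.

Definition kmod_scale (c : K) (x : kmod M) : kmod M := c%:MP *: (x : M).

Fact kmod_scaleA a b v : kmod_scale a (kmod_scale b v) = kmod_scale (a * b) v.
Proof. by rewrite /kmod_scale scalerA mpolyCM. Qed.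

Fact kmod_scale1 : left_id 1 kmod_scale.
Proof. by move=> v; rewrite /kmod_scale mpolyC1 scale1r. Qed.

Fact kmod_scaleDr : right_distributive kmod_scale +%R.
Proof. by move=> c x y; apply: scalerDr. Qed.

Fact kmod_scaleDl v : {morph kmod_scale^~ v : a b / a + b}.
Proof. by move=> a b; rewrite /kmod_scale mpolyCD scalerDl. Qed.

HB.instance Definition _ := GRing.Zmodule_isLmodule.Build K (kmod M)
  kmod_scaleA kmod_scale1 kmod_scaleDr kmod_scaleDl.

End KMod.

(** * From modules to decompositions *)

Lemma sum_by_degree (V : zmodType) (T : eqType) (L : seq (T * V)) (s : seq T) :
  uniq s -> (forall d, d \in L -> d.1 \in s) ->
  \sum_(d <- L) d.2 = \sum_(b <- s) \sum_(d <- L | d.1 == b) d.2.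
Proof.
move=> us Ls; rewrite (exchange_big_dep xpredT) //= [LHS]big_seq [RHS]big_seq.
apply: eq_bigr => d /Ls ds.
rewrite [RHS]big_mkcond (bigD1_seq _ ds us) /= eqxx [X in _ + X]big1 ?addr0 // => b.
by rewrite eq_sym => /negbTE ->.
Qed.

(** A sum of homogeneous elements in which a degree may occur repeatedly can be regrouped
into one with a single element in each degree. *)
Lemma graded_sum_of_list (V : zmodType) (n : nat) (P : zvec n -> V -> Prop)
    (L : seq (zvec n * V)) :
  (forall a, P a 0) -> (forall a x y, P a x -> P a y -> P a (x + y)) ->
  (forall d, d \in L -> P d.1 d.2) ->
  exists s f, (forall a, P a (f a)) /\ \sum_(d <- L) d.2 = \sum_(a <- s) f a.
Proof.
move=> P0 PD PL.
exists (undup (map fst L)), (fun b => \sum_(d <- L | d.1 == b) d.2); split=> [a|].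
  rewrite big_seq_cond; apply: big_ind => // [x y|d /andP [/PL] + /eqP <- //].
  exact: PD.
by apply: sum_by_degree => [|d dL]; rewrite ?undup_uniq // mem_undup map_f.
Qed.

Section GradedModuleTheory.
Variables (K : fieldType) (n : nat) (m : 'I_n -> nat) (M : gradedModule K m).
Local Notation N := (\sum_(i < n) m i)%N.
Implicit Types (a b : zvec n) (x y : M) (k : 'X_{1..N}).

Lemma gpieceD a x y : gpiece a x -> gpiece a y -> gpiece a (x + y).
Proof.
move=> ax ay; rewrite -[y]opprK; apply: gpieceB => //.
by rewrite -sub0r; apply: gpieceB => //; apply: gpiece0.
Qed.

Lemma gpiece_sumr a (J : Type) (r : seq J) (P : pred J) (F : J -> M) :
  (forall j, P j -> gpiece a (F j)) -> gpiece a (\sum_(j <- r | P j) F j).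
Proof. by move=> aF; apply: big_ind => //; [apply: gpiece0|apply: gpieceD]. Qed.

Lemma XdegD k l : Xdeg (k + l)%MM = Xdeg k + Xdeg l :> zvec n.
Proof.
apply/rowP => i; rewrite !mxE -PoszD -big_split; congr Posz.
by apply: eq_bigr => j _; rewrite mnmDE.
Qed.

Lemma gpieceX a k x : gpiece a x -> gpiece (Xdeg k + a) ('X_[k] *: x).
Proof. by apply: gpieceZ => l; rewrite msuppX inE => /eqP ->. Qed.

Lemma gpieceC a (c : K) x : gpiece a x -> gpiece a (c%:MP *: x).
Proof.
rewrite -[a in gpiece a (_ *: _)]add0r; apply: gpieceZ => l.
rewrite msuppC; case: eqP => // _; rewrite inE => /eqP ->.
by apply/rowP => i; rewrite !mxE big1 // => j _; rewrite mnm0E.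
Qed.

(** The components of degree other than a vanish since the pieces are independent. *)
Lemma homogeneous_component a x (L : seq (zvec n * M)) :
  (forall d, d \in L -> gpiece d.1 d.2) -> gpiece a x -> x = \sum_(d <- L) d.2 ->
  x = \sum_(d <- L | d.1 == a) d.2.
Proof.
move=> LM ax xL.
pose s := undup (a :: map fst L).
pose f b := \sum_(d <- L | d.1 == b) d.2 - (if b == a then x else 0).
have fM b : gpiece b (f b).
  apply: gpieceB; last by case: eqP => [->|_] //; apply: gpiece0.
  rewrite big_seq_cond; apply: gpiece_sumr => d /andP [/LM] + /eqP <-; exact.
have as_ : a \in s by rewrite mem_undup mem_head.
have fs0 : \sum_(b <- s) f b = 0.
  rewrite /f sumrB [X in _ - X](bigD1_seq a as_ (undup_uniq _)) /= eqxx.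
  rewrite [X in _ - (_ + X)]big1 ?addr0 => [|b /negbTE ->] //.
  apply/eqP; rewrite subr_eq0 xL; apply/eqP.
  apply/esym/sum_by_degree => [|d dL]; first exact: undup_uniq.
  by rewrite mem_undup inE map_f ?orbT.
have := gpiece_direct (undup_uniq _) fM fs0 as_.
by rewrite /f eqxx => /eqP; rewrite subr_eq0 => /eqP.
Qed.

Lemma homogeneous_generators : finitely_generated M ->
  exists G : seq (zvec n * M), (forall g, g \in G -> gpiece g.1 g.2) /\
    forall x, lspan [seq g.2 | g <- G] x.
Proof.
case=> r [g gM].
have [G [GM Gg]] : exists G : seq (zvec n * M), (forall h, h \in G -> gpiece h.1 h.2) /\
    forall i, i \in enum 'I_r -> lspan [seq h.2 | h <- G] (g i).
  elim: (enum _) => [|i l [G [GM Gg]]]; first by exists [::].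
  have [s [f [fM gi]]] := gpiece_sum (g i).
  exists ([seq (b, f b) | b <- s] ++ G); split=> [h|j].
    by rewrite mem_cat => /orP [/mapP [b _ ->] //=|/GM].
  rewrite inE map_cat => /predU1P [->|/Gg].
    rewrite gi [X in lspan _ X]big_seq; apply: lspan_sum => b bs; apply: mem_lspan.
    by rewrite mem_cat -map_comp (map_f (fun b => f b)).
  by apply: lspan_trans => v vG; apply: mem_lspan; rewrite mem_cat vG orbT.
exists G; split=> // x; have [c ->] := gM x.
by apply: lspan_sum => i _; apply/lspanZ/Gg; rewrite mem_enum.
Qed.

Definition sorted_monomials b : seq 'X_{1..N} := rev (sort <=%O (monomials m b)).

Lemma mem_sorted_monomials k b : (k \in sorted_monomials b) = (Xdeg k == b).
Proof. by rewrite mem_rev mem_sort mem_monomials. Qed.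

Lemma sorted_monomialsP b : sorted >%O (sorted_monomials b).
Proof.
rewrite rev_sorted -[sorted _ _]/(sorted <%O _) lt_sorted_uniq_le sort_uniq monomials_uniq /=.
exact: sort_le_sorted.
Qed.

Implicit Types (G : seq (zvec n * M)).

(** The multiples X^k g of degree a, with k decreasing for each generator g; the order of
this list decides which multiples are standard. *)
Fixpoint multiples G a : seq (kmod M) :=
  if G is g :: G' then [seq ('X_[k] *: g.2 : kmod M) | k <- sorted_monomials (a - g.1)] ++ multiples G' a
  else [::].

Lemma mem_multiples G a (x : kmod M) :
  x \in multiples G a <-> exists g k, [/\ g \in G, Xdeg k + g.1 = a & x = 'X_[k] *: g.2].
Proof.
elim: G => [|g G IH] /=; first by split=> [//|[g [k []]]].
rewrite mem_cat; split=> [/orP [/mapP [k]|/IH [h [k [hG ka ->]]]]|[h [k [hG ka xE]]]].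
- by rewrite mem_sorted_monomials => /eqP ka ->; exists g, k; rewrite mem_head ka subrK.
- by exists h, k; rewrite inE hG orbT.
- apply/orP; move: hG; rewrite inE => /predU1P [hg|hG]; [left|right].
    apply/mapP; exists k; last by rewrite xE hg.
    by rewrite mem_sorted_monomials -ka hg addrK.
  by apply/IH; exists h, k.
Qed.

Lemma multiplesX G a k (x : kmod M) : x \in multiples G a ->
  ('X_[k] *: (x : M) : kmod M) \in multiples G (Xdeg k + a).
Proof.
case/mem_multiples => g [l [gG la ->]]; apply/mem_multiples.
by exists g, (k + l)%MM; rewrite XdegD -addrA la scalerA mpolyXD.
Qed.

Lemma multiples_piece G a (x : kmod M) : (forall g, g \in G -> gpiece g.1 g.2) ->
  x \in multiples G a -> gpiece a (x : M).
Proof. by move=> GM /mem_multiples [g [k [/GM gM <- ->]]]; apply: gpieceX. Qed.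

(** Expand the coefficients of the generators into monomials and keep the terms of
degree a. *)
Lemma multiples_span G a x : (forall g, g \in G -> gpiece g.1 g.2) ->
  lspan [seq g.2 | g <- G] x -> gpiece a x -> lspan (multiples G a) (x : kmod M).
Proof.
move=> GM xG.
have [L LP xL] : exists2 L : seq (zvec n * M),
    forall d, d \in L -> gpiece d.1 d.2 /\ lspan (multiples G d.1) (d.2 : kmod M) &
    x = \sum_(d <- L) d.2.
  elim: G GM x xG => [|g G IH] GM x /=; first by move=> ->; exists [::]; rewrite ?big_nil.
  move=> [c /IH [h hG|L LP xL]]; first by apply: GM; rewrite inE hG orbT.
  exists ([seq (Xdeg k + g.1, (c@_k)%:MP *: ('X_[k] *: g.2)) | k <- msupp c] ++ L).
    move=> d; rewrite mem_cat => /orP [/mapP [k _ ->] /=|/LP [dM dG]].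
      split; first exact/gpieceC/gpieceX/GM/mem_head.
      apply: (@lspanZ _ (kmod M) _ c@_k); apply: mem_lspan; rewrite mem_cat.
      apply/orP; left; apply/mapP; exists k => //.
      by rewrite mem_sorted_monomials addrK.
    split=> //; apply: lspan_trans dG => v vG; apply: mem_lspan.
    by rewrite mem_cat vG orbT.
  rewrite big_cat big_map /= -xL.
  rewrite [X in X + _](_ : _ = c *: g.2) 1?addrC ?subrK //.
  rewrite [in RHS](mpolyE c) scaler_suml; apply: eq_bigr => k _.
  by rewrite scalerA mul_mpolyC.
move=> ax; rewrite (homogeneous_component _ ax xL) => [|d /LP [] //].
rewrite [X in lspan _ X]big_seq_cond; apply: (@lspan_sum _ (kmod M)) => d /andP [/LP [_ dG] /eqP <-].
exact: dG.
Qed.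

Lemma gpiece_dim_greedy G a d : (forall g, g \in G -> gpiece g.1 g.2) ->
  (forall x, lspan [seq g.2 | g <- G] x) -> gpiece_dim M a d ->
  d = size (greedy (multiples G a)).
Proof.
move=> GM Gspan [e [eM espan efree]].
set B := greedy _.
have Bspan (x : M) : gpiece a x -> lspan B (x : kmod M).
  by move=> ax; apply/greedy_span/multiples_span.
have BM (i : 'I_(size B)) : gpiece a (B`_i : M).
  by apply: (multiples_piece GM); apply: greedy_sub; exact: (mem_nth 0 (ltn_ord i)).
apply/eqP; rewrite eqn_leq; apply/andP; split.
  apply: (@independent_leq _ (kmod M) _ _ (fun i => B`_i) e) => [c|j].
    exact: efree.
  by apply/lspanP/Bspan.
apply: (@independent_leq _ (kmod M) _ _ e (fun i => B`_i)) => [c|j].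
  exact/lfreeP/greedy_free.
exact: espan (BM j).
Qed.

(** For each generator g, the exponents k such that X^k g is standard are closed under
divisors: if X^k g depends on later multiples, multiplying this relation by a monomial
shows the same for every multiple of X^k g. *)
Lemma size_greedy_decomposable G :
  decomposable m (fun a => (size (greedy (multiples G a)))%:Z).
Proof.
elim: G => [|g G IH]; first exact: decomposable0.
pose v k : kmod M := 'X_[k] *: g.2.
pose T k := [seq v l | l <- sorted_monomials (Xdeg k) & (l < k)%O] ++ multiples G (Xdeg k + g.1).
pose D k := ~~ `[< lspan (T k) (v k) >].
have down k l : (k <= l)%MM -> D l -> D k.
  move=> kl; apply: contra => /asboolP kT; apply/asboolP.
  have vl : v l = 'X_[l - k] *: (v k : M) by rewrite /v scalerA -mpolyXD submK.
  rewrite vl; have lin (c : K) (y z : kmod M) :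
      'X_[l - k] *: (y - c *: z : M) = 'X_[l - k] *: (y : M) - c *: ('X_[l - k] *: (z : M) : kmod M) :> kmod M.
    by rewrite scalerBr; congr (_ - _); rewrite [LHS]scalerA [RHS]scalerA mulrC.
  apply: lspan_trans (lspan_map lin kT) => w; rewrite map_cat mem_cat => /orP [].
    case/mapP => u /mapP [j]; rewrite mem_filter mem_sorted_monomials => /andP [jk /eqP jd] -> ->.
    apply: mem_lspan; rewrite mem_cat; apply/orP; left; apply/mapP.
    exists (l - k + j)%MM; last by rewrite /v scalerA mpolyXD.
    rewrite mem_filter mem_sorted_monomials -{2 4}(submK kl) !XdegD jd eqxx andbT.
    by rewrite ltmc_add2r.
  case/mapP => u uG ->; apply: mem_lspan; rewrite mem_cat; apply/orP; right.
  by have := multiplesX (l - k) uG; rewrite addrA -XdegD submK.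
have dD := decomposable_shift g.1 (decomposable_monomials down).
apply: decomposable_ext (decomposableD dD IH) => a /=.
rewrite (greedy_count v _ (sorted_monomialsP _)) PoszD; congr (Posz _ + _).
rewrite count_rev -(permP (permEl (perm_sort <=%O _))); apply: eq_in_count => k.
by rewrite mem_sort mem_monomials => /eqP ka; rewrite /D /T ka subrK.
Qed.

Lemma hilbert_series_decomposable H : finitely_generated M -> is_hilbert_series M H ->
  decomposable m H.
Proof.
case/homogeneous_generators => G [GM Gspan] HM.
apply: decomposable_ext (size_greedy_decomposable G) => a.
by have [d /(gpiece_dim_greedy GM Gspan) -> ->] := HM a.
Qed.

End GradedModuleTheory.

(** * Cyclic modules *)

Section Homogeneous.
Variables (K : fieldType) (n : nat) (m : 'I_n -> nat).
Local Notation N := (\sum_(i < n) m i)%N.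
Implicit Types (a b : zvec n) (p q : {mpoly K[N]}).

Lemma homogeneous0 a : homogeneous a (0 : {mpoly K[N]}).
Proof. by move=> k; rewrite msupp0. Qed.

Lemma homogeneousD a p q : homogeneous a p -> homogeneous a q -> homogeneous a (p + q).
Proof. by move=> ap aq k /msuppD_le; rewrite mem_cat => /orP [/ap|/aq]. Qed.

Lemma homogeneousB a p q : homogeneous a p -> homogeneous a q -> homogeneous a (p - q).
Proof. by move=> ap aq k /msuppB_le; rewrite mem_cat => /orP [/ap|/aq]. Qed.

Lemma homogeneousM a b p q : homogeneous a p -> homogeneous b q -> homogeneous (a + b) (p * q).
Proof. by move=> ap bq k /msuppM_le /allpairsP [[k1 k2] /= [/ap <- /bq <- ->]]; rewrite XdegD. Qed.

Lemma homogeneousX k : homogeneous (Xdeg k) ('X_[k] : {mpoly K[N]}).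
Proof. by move=> l; rewrite msuppX inE => /eqP ->. Qed.

Lemma homogeneousC c : homogeneous 0 (c%:MP : {mpoly K[N]}).
Proof.
move=> l; rewrite msuppC; case: eqP => // _; rewrite inE => /eqP ->.
by apply/rowP => i; rewrite !mxE big1 // => j _; rewrite mnm0E.
Qed.

Lemma homogeneous_sum a (J : Type) (r : seq J) (P : pred J) (F : J -> {mpoly K[N]}) :
  (forall j, P j -> homogeneous a (F j)) -> homogeneous a (\sum_(j <- r | P j) F j).
Proof. by move=> aF; apply: (big_ind (homogeneous a)) => //; [apply: homogeneous0|apply: homogeneousD]. Qed.

Lemma Xdeg_sum (k : 'X_{1..N}) : Xdeg k = \sum_x (k x)%:Z *: evec (tagnat.sig1 x).
Proof.
apply/rowP => i; rewrite mxE summxE -sum_tagnat_fiber (big_morph Posz PoszD (erefl 0)).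
apply: eq_bigr => x _; rewrite mxE evecE eq_sym; case: eqP => _.
  by rewrite mul1n mulr1.
by rewrite mul0n mulr0.
Qed.

Lemma XdegU (x : 'I_N) : Xdeg U_(x)%MM = evec (tagnat.sig1 x).
Proof.
rewrite Xdeg_sum (bigD1 x) //= mnm1E eqxx scale1r big1 ?addr0 // => y.
by rewrite mnm1E eq_sym => /negbTE ->; rewrite scale0r.
Qed.

End Homogeneous.

(** For z <= m, the quotient of R by the X_ij with j >= z_i (counting from 0) is a polynomial
ring on the remaining variables, on which R acts through the evaluation [kill_vars]. *)
Definition cyclic_carrier (K : fieldType) (n : nat) (m z : 'I_n -> nat) : Type :=
  {mpoly K[(\sum_(i < n) z i)%N]}.

Section Cyclic.
Variables (K : fieldType) (n : nat) (m z : 'I_n -> nat) (q : zvec n).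
Local Notation N := (\sum_(i < n) m i)%N.
Local Notation N' := (\sum_(i < n) z i)%N.
Local Notation C := (cyclic_carrier K m z).

Definition kill_var_tag (p : {i : 'I_n & 'I_(m i)}) : {mpoly K[N']} :=
  if insub (tagged p : nat) is Some j then 'X_(tagnat.Rank (tag p) j) else 0.

Definition kill_vars : {mpoly K[N]} -> {mpoly K[N']} :=
  mmap (mpolyC N' (R := K)) (fun x => kill_var_tag (tagnat.sig x)).

HB.instance Definition _ := GRing.RMorphism.copy kill_vars
  (mmap (mpolyC N' (R := K)) (fun x => kill_var_tag (tagnat.sig x))).

HB.instance Definition _ := GRing.Zmodule.copy C {mpoly K[N']}.

Definition cyclic_scale (p : {mpoly K[N]}) (f : C) : C := kill_vars p * (f : {mpoly K[N']}).

Fact cyclic_scaleA a b v : cyclic_scale a (cyclic_scale b v) = cyclic_scale (a * b) v.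
Proof. by rewrite /cyclic_scale rmorphM mulrA. Qed.

Fact cyclic_scale1 : left_id 1 cyclic_scale.
Proof. by move=> v; rewrite /cyclic_scale rmorph1 mul1r. Qed.

Fact cyclic_scaleDr : right_distributive cyclic_scale +%R.
Proof. by move=> c x y; apply: mulrDr. Qed.

Fact cyclic_scaleDl v : {morph cyclic_scale^~ v : a b / a + b}.
Proof. by move=> a b; rewrite /cyclic_scale rmorphD mulrDl. Qed.

HB.instance Definition _ := GRing.Zmodule_isLmodule.Build {mpoly K[N]} C
  cyclic_scaleA cyclic_scale1 cyclic_scaleDr cyclic_scaleDl.

Definition cyclic_piece (a : zvec n) (f : C) : Prop := homogeneous (a - q) (f : {mpoly K[N']}).

Lemma kill_vars_homogeneous b p : homogeneous b p -> homogeneous b (kill_vars p).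
Proof.
move=> bp; rewrite /kill_vars /mmap big_seq; apply: homogeneous_sum => k /bp <-.
rewrite -[Xdeg k]add0r; apply: homogeneousM; first exact: homogeneousC.
rewrite Xdeg_sum /mmap1.
apply: (big_ind2 (fun a (f : {mpoly K[N']}) => homogeneous a f)) => [|a f b' g|x _].
- by rewrite -mpolyC1; apply: homogeneousC.
- exact: homogeneousM.
have hx : homogeneous (evec (tagnat.sig1 x)) (kill_var_tag (tagnat.sig x)).
  rewrite /kill_var_tag; case: insubP => [j _ _|_]; last exact: homogeneous0.
  by have := homogeneousX (K := K) (m := z) (k := U_(tagnat.Rank (tag (tagnat.sig x)) j)%MM); rewrite XdegU tagnat.Rank1K.
elim: (k x) => [|e IH]; first by rewrite scale0r expr0 -mpolyC1; apply: homogeneousC.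
by rewrite exprS -(add1n e) PoszD scalerDl scale1r; apply: homogeneousM.
Qed.

Fact cyclic_piece0 a : cyclic_piece a 0.
Proof. exact: homogeneous0. Qed.

Fact cyclic_pieceB a x y : cyclic_piece a x -> cyclic_piece a y -> cyclic_piece a (x - y).
Proof. exact: homogeneousB. Qed.

Fact cyclic_pieceZ a b (p : Xring K m) (x : C) :
  homogeneous b p -> cyclic_piece a x -> cyclic_piece (b + a) (p *: x).
Proof.
by move=> /kill_vars_homogeneous bp ax; rewrite /cyclic_piece -addrA; apply: homogeneousM.
Qed.

Fact cyclic_piece_sum (x : C) : exists (s : seq (zvec n)) (f : zvec n -> C),
  (forall a, cyclic_piece a (f a)) /\ x = \sum_(a <- s) f a.
Proof.
pose L := [seq (Xdeg k + q, x@_k *: 'X_[k] : {mpoly K[N']}) | k <- msupp x].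
have [|a f g|d|s [f [fP e]]] := @graded_sum_of_list {mpoly K[N']} n cyclic_piece L.
- exact: cyclic_piece0.
- exact: homogeneousD.
- case/mapP => k _ -> /= l /msuppZ_le; rewrite msuppX inE => /eqP ->.
  by rewrite addrK.
exists s, f; split=> //; rewrite -[RHS]e big_map /=; exact: mpolyE.
Qed.

Fact cyclic_piece_direct (s : seq (zvec n)) (f : zvec n -> C) :
  uniq s -> (forall a, cyclic_piece a (f a)) ->
  \sum_(a <- s) f a = 0 -> forall a, a \in s -> f a = 0.
Proof.
move=> us fP f0 a as_; apply/mpolyP => k; rewrite mcoeff0.
have out b : Xdeg k != b - q -> (f b : {mpoly K[N']})@_k = 0.
  by move=> kb; apply: memN_msupp_eq0; apply: contra kb => /fP ->.
have [ka|/out //] := eqVneq (Xdeg k) (a - q).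
have := congr1 (mcoeff k) (f0 : \sum_(a <- s) (f a : {mpoly K[N']}) = 0).
rewrite mcoeff0 raddf_sum (bigD1_seq a) //= [X in _ + X]big1 ?addr0 // => b ba; apply: out.
by rewrite ka; apply: contra ba => /eqP/addIr ->.
Qed.

Definition cyclic_module : gradedModule K m :=
  @GradedModule K n m C cyclic_piece cyclic_piece0 cyclic_pieceB cyclic_pieceZ
    cyclic_piece_sum cyclic_piece_direct.

(** The monomials in the remaining variables, of degree a - q, form a basis of the
piece of degree a. *)
Lemma cyclic_hilbert :
  is_hilbert_series cyclic_module (basic_series q [multinom z i | i < n]).
Proof.
move=> a; exists (size (monomials z (a - q))); last first.
  rewrite size_monomials /basic_series; apply: eq_bigr => i _.
  by rewrite !mxE subr0.
set ks := monomials z (a - q).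
have scE (c : K) (x : C) : c%:MP *: x = c *: (x : {mpoly K[N']}) :> {mpoly K[N']}.
  by rewrite -mul_mpolyC; congr (_ * _); apply: mmapC.
exists (fun i => 'X_[tnth (in_tuple ks) i] : {mpoly K[N']}); split.
- move=> i l; rewrite msuppX inE => /eqP ->.
  by apply/eqP; rewrite -mem_monomials mem_tnth.
- move=> x xa; exists (fun i => (x : {mpoly K[N']})@_(tnth (in_tuple ks) i)).
  have xE : x = \sum_(k <- ks) (x : {mpoly K[N']})@_k *: 'X_[k] :> {mpoly K[N']}.
    rewrite {1}[x : {mpoly K[N']}]mpolyE [RHS](bigID (mem (msupp (x : {mpoly K[N']})))) /=.
    rewrite [X in _ + X]big1 ?addr0 => [|k /memN_msupp_eq0 ->]; last by rewrite scale0r.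
    rewrite -[RHS]big_filter; apply: perm_big; apply: uniq_perm.
    + exact: msupp_uniq.
    + by rewrite filter_uniq ?monomials_uniq.
    move=> k; rewrite mem_filter; case: (boolP (k \in _)) => //= /xa xk.
    by rewrite mem_monomials xk eqxx.
  by rewrite [LHS]xE [LHS]big_tnth; apply: eq_bigr => i _; rewrite scE.
move=> c c0 i; pose k := tnth (in_tuple ks) i.
have : (\sum_(j < size ks) c j *: 'X_[tnth (in_tuple ks) j] : {mpoly K[N']})@_k = 0.
  rewrite -[RHS](mcoeff0 K k) -[0 in RHS]c0; congr mcoeff.
  by apply: eq_bigr => j _; rewrite scE.
rewrite raddf_sum (bigD1 i) //= mcoeffZ mcoeffX eqxx mulr1 [X in _ + X]big1 ?addr0 // => j ji.
rewrite mcoeffZ mcoeffX; case: eqP => [e|]; last by rewrite mulr0.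
case/negP: ji; apply/eqP/val_inj/eqP.
move: e; rewrite /k !(tnth_nth 0%MM) /= => /eqP.
by rewrite nth_uniq ?monomials_uniq.
Qed.

Hypothesis zm : forall i, (z i <= m i)%N.

(** The remaining variables are images of variables of R, so 1 generates the module. *)
Lemma kill_vars_surj (f : {mpoly K[N']}) : exists p, kill_vars p = f.
Proof.
pose iota (y : 'I_N') : 'I_N := tagnat.rank
  (Tagged (fun i => 'I_(m i)) (widen_ord (zm (tag (tagnat.sig y))) (tagged (tagnat.sig y)))).
have hX y : kill_vars 'X_(iota y) = 'X_y.
  rewrite /kill_vars mmapX mmap1U /iota tagnat.rankK /kill_var_tag /=.
  by rewrite valK -tagnat.rankE tagnat.sigK.
exists (mmap (mpolyC N (R := K)) (fun y => 'X_(iota y)) f).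
rewrite {1}/mmap rmorph_sum [RHS]mpolyE; apply: eq_bigr => k _.
rewrite rmorphM /= -mul_mpolyC; congr (_ * _); first exact: mmapC.
rewrite rmorph_prod [RHS]mpolyXE_id; apply: eq_bigr => y _.
by rewrite rmorphXn /= hX.
Qed.

Lemma cyclic_fg : finitely_generated cyclic_module.
Proof.
exists 1%N, (fun=> (1 : {mpoly K[N']})) => x; have [p px] := kill_vars_surj x.
by exists (fun=> p); rewrite big_ord1 -[RHS]/(kill_vars p * 1) mulr1.
Qed.

End Cyclic.

(** * Direct sums *)

Section DirectSum.
Variables (K : fieldType) (n : nat) (m : 'I_n -> nat).
Local Notation N := (\sum_(i < n) m i)%N.

Section ZeroModule.
Let V : lmodType {mpoly K[N]} := 'rV[{mpoly K[N]}]_0.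

Definition zero_module : gradedModule K m.
Proof.
apply: (@GradedModule K n m V (fun _ _ => True)) => //.
  by move=> x; exists [::], (fun=> 0); rewrite big_nil; split=> //; apply: thinmx0.
by move=> s f *; apply: thinmx0.
Defined.

Lemma zero_module_fg : finitely_generated zero_module.
Proof. by exists 0%N, (fun=> 0) => x; exists (fun=> 0); rewrite big_ord0; apply: thinmx0. Qed.

Lemma zero_module_hilbert : is_hilbert_series zero_module (fun=> 0).
Proof.
move=> a; exists 0%N => //; exists (fun=> 0); split=> // [x _|c _ []//].
by exists (fun=> 0); rewrite big_ord0; apply: thinmx0.
Qed.

End ZeroModule.

Variables M1 M2 : gradedModule K m.
Let V : lmodType {mpoly K[N]} := (M1 * M2)%type.

Definition sum_piece a (x : V) := gpiece a x.1 /\ gpiece a x.2.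

Lemma sum_fst (J : Type) (r : seq J) (F : J -> V) : (\sum_(j <- r) F j).1 = \sum_(j <- r) (F j).1.
Proof. exact: (big_morph fst). Qed.

Lemma sum_snd (J : Type) (r : seq J) (F : J -> V) : (\sum_(j <- r) F j).2 = \sum_(j <- r) (F j).2.
Proof. exact: (big_morph snd). Qed.

Fact sum_piece0 a : sum_piece a 0.
Proof. by split; apply: gpiece0. Qed.

Fact sum_pieceB a x y : sum_piece a x -> sum_piece a y -> sum_piece a (x - y).
Proof. by move=> [x1 x2] [y1 y2]; split; apply: gpieceB. Qed.

Fact sum_pieceZ a b (p : Xring K m) x :
  homogeneous b p -> sum_piece a x -> sum_piece (b + a) (p *: x).
Proof. by move=> bp [x1 x2]; split; apply: gpieceZ. Qed.

Fact sum_piece_sum (x : V) : exists (s : seq (zvec n)) (f : zvec n -> V),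
  (forall a, sum_piece a (f a)) /\ x = \sum_(a <- s) f a.
Proof.
have [s1 [f1 [f1P x1]]] := gpiece_sum x.1; have [s2 [f2 [f2P x2]]] := gpiece_sum x.2.
pose L : seq (zvec n * V) := [seq (b, (f1 b, 0)) | b <- s1] ++ [seq (b, (0, f2 b)) | b <- s2].
have [|a y z [y1 y2] [z1 z2]|d|s [f [fP e]]] := @graded_sum_of_list V n sum_piece L.
- exact: sum_piece0.
- by split; apply: gpieceD.
- by rewrite mem_cat => /orP [] /mapP [b _ ->]; split=> //=; apply: gpiece0.
exists s, f; split=> //; rewrite -[RHS]e big_cat !big_map /=.
apply: injective_projections; rewrite /= !(sum_fst, sum_snd) /=.
  by rewrite [X in _ + X]big1 // addr0.
by rewrite [X in X + _]big1 // add0r.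
Qed.

Fact sum_piece_direct (s : seq (zvec n)) (f : zvec n -> V) :
  uniq s -> (forall a, sum_piece a (f a)) ->
  \sum_(a <- s) f a = 0 -> forall a, a \in s -> f a = 0.
Proof.
move=> us fP f0 a as_; apply: injective_projections.
  apply: (gpiece_direct us (fun a => (fP a).1)) as_.
  by rewrite -sum_fst f0.
apply: (gpiece_direct us (fun a => (fP a).2)) as_.
by rewrite -sum_snd f0.
Qed.

Definition sum_module : gradedModule K m :=
  @GradedModule K n m V sum_piece sum_piece0 sum_pieceB sum_pieceZ sum_piece_sum sum_piece_direct.

Definition pair_family d1 d2 (e1 : 'I_d1 -> M1) (e2 : 'I_d2 -> M2) (i : 'I_(d1 + d2)) : V :=
  match split i with inl j => (e1 j, 0) | inr j => (0, e2 j) end.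

Definition pair_coef (T : Type) d1 d2 (c1 : 'I_d1 -> T) (c2 : 'I_d2 -> T) (i : 'I_(d1 + d2)) : T :=
  match split i with inl j => c1 j | inr j => c2 j end.

Lemma split_lshift d1 d2 (j : 'I_d1) : split (lshift d2 j) = inl j.
Proof. exact: (unsplitK (inl j)). Qed.

Lemma split_rshift d1 d2 (j : 'I_d2) : split (rshift d1 j) = inr j.
Proof. exact: (unsplitK (inr j)). Qed.

Lemma pair_family_sum d1 d2 (e1 : 'I_d1 -> M1) (e2 : 'I_d2 -> M2) (c : 'I_(d1 + d2) -> {mpoly K[N]}) :
  \sum_i c i *: pair_family e1 e2 i =
  (\sum_i c (lshift d2 i) *: e1 i, \sum_i c (rshift d1 i) *: e2 i).
Proof.
rewrite big_split_ord /=; apply: injective_projections; rewrite /= !(sum_fst, sum_snd) /=.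
  rewrite [X in _ + X]big1 => [|i _]; last by rewrite /pair_family split_rshift scaler0.
  by rewrite addr0; apply: eq_bigr => i _; rewrite /pair_family split_lshift.
rewrite [X in X + _]big1 => [|i _]; last by rewrite /pair_family split_lshift scaler0.
by rewrite add0r; apply: eq_bigr => i _; rewrite /pair_family split_rshift.
Qed.

Lemma sum_module_fg : finitely_generated M1 -> finitely_generated M2 -> finitely_generated sum_module.
Proof.
move=> [r1 [g1 g1P]] [r2 [g2 g2P]]; exists (r1 + r2)%N, (pair_family g1 g2) => x.
have [c1 x1] := g1P x.1; have [c2 x2] := g2P x.2.
exists (pair_coef c1 c2); rewrite [RHS]pair_family_sum.
apply: injective_projections; rewrite /= ?x1 ?x2; apply: eq_bigr => i _.
  by rewrite /pair_coef split_lshift.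
by rewrite /pair_coef split_rshift.
Qed.

Lemma sum_module_hilbert H1 H2 : is_hilbert_series M1 H1 -> is_hilbert_series M2 H2 ->
  is_hilbert_series sum_module (fun a => H1 a + H2 a).
Proof.
move=> h1 h2 a; have [d1 [e1 [e1P s1 i1]] ->] := h1 a; have [d2 [e2 [e2P s2 i2]] ->] := h2 a.
exists (d1 + d2)%N; last by rewrite PoszD.
exists (pair_family e1 e2); split.
- move=> i; rewrite /pair_family; case: (split i) => j; split=> //=; exact: gpiece0.
- move=> x [/s1 [c1 x1] /s2 [c2 x2]]; exists (pair_coef c1 c2).
  rewrite [RHS](pair_family_sum e1 e2 (fun i => (pair_coef c1 c2 i)%:MP)).
  apply: injective_projections; rewrite /= ?x1 ?x2; apply: eq_bigr => i _.
    by rewrite /pair_coef split_lshift.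
  by rewrite /pair_coef split_rshift.
move=> c; rewrite [X in X = _ -> _](pair_family_sum e1 e2 (fun i => (c i)%:MP)) => -[/i1 c1 /i2 c2] i.
by rewrite -[i]splitK; case: (split i) => j /=; [apply: c1|apply: c2].
Qed.

End DirectSum.

Lemma decomposable_module (K : fieldType) n (m : 'I_n -> nat) (H : zseries n) :
  decomposable m H -> exists M : gradedModule K m, finitely_generated M /\ is_hilbert_series M H.
Proof.
move=> [s sm /funext ->]; elim: s sm => [|[q z] s IH] sm.
  exists (zero_module K m); split; first exact: zero_module_fg.
  rewrite (_ : decomposition [::] = fun=> 0); first exact: zero_module_hilbert.
  by apply/funext => a; rewrite /decomposition big_nil.
have [|M [Mfg MH]] := IH; first by move=> x xs; apply: sm; rewrite inE xs orbT.
have zm : forall i, (z i <= m i)%N := sm _ (mem_head _ _).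
exists (sum_module (cyclic_module K m z q) M); split.
  by apply: sum_module_fg => //; apply: cyclic_fg.
have -> : decomposition ((q, z) :: s) = fun a => basic_series q z a + decomposition s a.
  by apply/funext => a; rewrite /decomposition big_cons.
apply: sum_module_hilbert => //.
rewrite -[z in basic_series q z](_ : [multinom z i | i < n] = z); first exact: cyclic_hilbert.
by apply/mnmP => i; rewrite mnmE.
Qed.

Theorem theorem3p5 (K : fieldType) (n : nat) (m : 'I_n -> nat)
    (H : zseries n) (hH : is_laurent_series H) :
  (exists M : gradedModule K m,
     finitely_generated M /\ is_hilbert_series M H)
  <->
  (is_laurent_polynomial
     (mul_series (\prod_(i < n) (1 - 'X_i) ^+ m i) H) /\
   forall (u : zvec n) (I : {set 'I_n}),
     exists2 p : {mpoly rat[n]},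
       is_hilbert_polynomial I (restriction H I u) p &
       has_positive_extremal_coefficients p).
Proof.
split=> [[M [Mfg MH]]|[Hpoly hilbert_pos]].
  have dH := hilbert_series_decomposable Mfg MH; split; first exact: decomposable_laurent.
  by move=> u I; apply: decomposable_hilbert dH.
by apply/decomposable_module/hilbert_decomposable => //; apply: laurent_fdiff0.
Qed.
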